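(* Let $(U_N)$ and $(\widetilde U_N)$ be families of operators satisfying Hypotheses 1 and 2 (stated in the context). Let $a_1<a_2\in\mathbb{R}$ and let $a_3>0$. There exists a constant $C$ depending on $a_1,a_2,a_3$ and on the constants in Hypotheses 1 and 2, but not on $N$, such that the following holds. Let $(\delta_N)$ be a bounded sequence of positive numbers, possibly going to zero. Then there exists $N_0$ such that for all $N\ge N_0$, $$\mathcal{N}_{a_1,a_2,-a_3,-\delta_N}(U_N)\le\frac{C\gamma_N}{\delta_N^{5/2}}.$$ In particular, if $\gamma_N=o(N)$ and $\Omega\subset\mathbb{C}$ is a bounded set such that $\overline\Omega\cap\mathbb{R}=\emptyset$, then $$\frac{1}{N}\mathcal{N}_\Omega(U_N)\underset{N\to\infty}{\longrightarrow}0.$$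
   Context: Let $Y_0\in(0,+\infty]$ and $\mathbb{C}^{Y_0}=\{z\in\mathbb{C}:\Im z<Y_0\}$. For each $N\in\mathbb{N}$, $\mathcal{H}_N$ is a Hilbert space and $U_N(z):\mathcal{H}_N\to\mathcal{H}_N$ is a family of trace-class operators depending holomorphically on $z\in\mathbb{C}^{Y_0}$. $\|\cdot\|$ is the operator norm and $\|\cdot\|_1$ the trace norm. A resonance of $U_N$ is a solution $z\in\mathbb{C}^{Y_0}$ of $\det(U_N(z)-\mathrm{Id})=0$ (equivalently, $\ker(U_N(z)-\mathrm{Id})\ne\{0\}$); its multiplicity is $\dim\ker(U_N(z)-\mathrm{Id})$. For $\Omega\subset\mathbb{C}$, $\mathcal{N}_\Omega(U_N)$ is the number of resonances of $U_N$ in $\Omega$ counted with multiplicity, and $\mathcal{N}_{a,b,c,d}(U_N)=\mathcal{N}_{\mathcal{R}_{a,b,c,d}}(U_N)$ with $\mathcal{R}_{a,b,c,d}=\{z\in\mathbb{C}:a\le\Re z\le b,\ c\le\Im z\le d\}$. Hypothesis 1. 1. For any $N$, $U_N$ has no resonances in $\{0<\Im z<Y_0\}$. 2. For every compact $\mathcal{K}\subset\{0<\Im z<Y_0\}$ there is $C_0(\mathcal{K})>0$ independent of $N$ such that $\|(\mathrm{Id}-U_N(z))^{-1}\|\le\frac{C_0(\mathcal{K})}{|\Im z|}$ for all $N$ and $z\in\mathcal{K}$. 3. There exists $Y_1>0$ such that for any $N$, $U_N$ has no resonances in $\{\Im z\le-Y_1\}$; and for every compact $\mathcal{K}\subset\{\Im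 z\le-Y_1\}$ there is $C_0'(\mathcal{K})>0$ independent of $N$ such that $\|(\mathrm{Id}-U_N(z))^{-1}\|\le C_0'(\mathcal{K})$ for all $N$ and $z\in\mathcal{K}$. 4. For every compact $\mathcal{K}\subset\mathbb{C}^{Y_0}$ there is $C_1(\mathcal{K})>0$ such that $\|U_N(z)\|\le C_1(\mathcal{K})$ for all $N$ and $z\in\mathcal{K}$. Hypothesis 2. For each $N$ there is another family $\widetilde U_N(z):\mathcal{H}_N\to\mathcal{H}_N$ of invertible operators depending holomorphically on $z\in\mathbb{C}^{Y_0}$ such that: 1. For every compact $\mathcal{K}\subset\mathbb{C}^{Y_0}$ there is a constant $c(\mathcal{K})>0$ such that for all $N$ and $z\in\mathcal{K}$: if $\Im z>0$ then $\|\widetilde U_N(z)\|\le\frac{1}{1+c(\mathcal{K})\Im z}$; if $\Im z<0$ then $\|\widetilde U_N(z)^{-1}\|\le\frac{1}{1+c(\mathcal{K})|\Im z|}$. (In particular $\|(\mathrm{Id}-\widetilde U_N(z))^{-1}\|\le C_2(\mathcal{K})/|\Im z|$ for $z\in\mathcal{K}\setminus\mathbb{R}$.) 2. There is a sequence $(\gamma_N)$ of positive numbers such that for every compact $\mathcal{K}\subset\mathbb{C}^{Y_0}$ there is $C(\mathcal{K})$ independent of $N$ with $\|U_N(z)-\widetilde U_N(z)\|_1\le C(\mathcal{K})\gamma_N$ for all $N$ and all $z\in\mathcal{K}$. *)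

(* Defs.v *)
From HB Require Import structures.
From mathcomp Require Import all_boot all_order all_algebra finmap complex.
From mathcomp Require Import all_classical all_reals all_analysis.
From mathcomp Require Import showcase.summability.

Set Implicit Arguments.
Unset Strict Implicit.
Unset Printing Implicit Defensive.

Import Order.TTheory GRing.Theory Num.Theory numFieldNormedType.Exports.

Local Open Scope classical_set_scope.
Local Open Scope ring_scope.
Local Open Scope complex_scope.

(* The topology and norm of R[i] are those every numFieldType carries. *)
HB.instance Definition _ (R : realType) := NormedModule.copy R[i] (R[i]^o).

(* The inner product is linear on the left and antilinear on the right. *)
HB.mixin Record isHilbert (R : realType) (H : Type)
    of CompleteNormedModule R[i] H := {
  hdot : {dot H for Num.conj} ;
  hdotE : forall x : H, `|x| ^+ 2 = hdot x x
}.

#[short(type="hilbertType")]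
HB.structure Definition Hilbert (R : realType) :=
  {H of isHilbert R H & CompleteNormedModule R[i] H}.

Section operators.
Context {R : realType} {H : hilbertType R}.
Implicit Types A B T V : {linear H -> H}.

(* Norms of vectors are nonnegative reals seen in R[i], hence the Re. *)
Definition opnorm (f : H -> H) : \bar R :=
  ereal_sup [set (complex.Re `|f x|)%:E | x in [set x : H | `|x| <= 1]].

Definition bounded_op A := (opnorm A < +oo)%E.

Definition inverse_op (f : H -> H) V :=
  [/\ bounded_op V, cancel f V & cancel V f].

Definition inverse_norm_le (f : H -> H) (M : R) :=
  exists V, inverse_op f V /\ (opnorm V <= M%:E)%E.

Definition hilbert_basis (I : choiceType) (e : I -> H) :=
  (forall i j, hdot (e i) (e j) = (i == j)%:R) /\
  (forall x, (forall i, hdot x (e i) = 0) -> x = 0).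

(* A = |T|, the positive square root of T* T: as A is self-adjoint, the last *)
(* clause says that A ^ 2 = T* T.                                            *)
Definition absolute_value (T : H -> H) A :=
  [/\ bounded_op A, forall x, 0 <= hdot (A x) x &
      forall x y, hdot (A x) (A y) = hdot (T x) (T y)].

(* Trace of |T|. For a bounded linear T the set is a singleton, as |T| exists *)
(* and is unique and its trace does not depend on the basis; for an unbounded *)
(* T it is empty and the infimum is +oo.                                      *)
Definition trace_norm (T : H -> H) : \bar R :=
  ereal_inf [set t | exists A (I : choiceType) (e : I -> H),
    [/\ absolute_value T A, hilbert_basis e &
        t = \esum_(i in [set: I]) (complex.Re (hdot (A (e i)) (e i)))%:E]].

Definition trace_class T := bounded_op T /\ (trace_norm T < +oo)%E.

(* det B = d for B = Id + (trace class): the limit of the principal minors of *)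
(* the matrix of B in an orthonormal basis, along finite sets of indices.     *)
Definition is_fredholm_det (B : H -> H) (d : R[i]) :=
  forall (I : choiceType) (e : I -> H), hilbert_basis e ->
    \det (\matrix_(i < #|` J|, j < #|` J|)
      hdot (B (map e J)`_j) (map e J)`_i) @[J --> totally] --> d.

Definition dim_ker (f : H -> H) : \bar R :=
  ereal_sup [set n%:R%:E | n in [set n | exists v : 'I_n -> H,
    (forall i, f (v i) = 0) /\
    (forall c : 'I_n -> R[i], \sum_i c i *: v i = 0 -> forall i, c i = 0)]].

(* Complex differentiability for the operator norm. *)
Definition holomorphic_at (U : R[i] -> {linear H -> H}) (z : R[i]) :=
  exists D, bounded_op D /\
    opnorm (fun x => (w - z)^-1 *: (U w x - U z x) - D x) @[w --> z^'] --> 0%E.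

End operators.

Section resonances.
Context {R : realType}.

Definition half_plane (Y0 : \bar R) : set R[i] :=
  [set z | ((complex.Im z)%:E < Y0)%E].

Definition rectangle (a b c d : R) : set R[i] :=
  [set z | a <= complex.Re z <= b /\ c <= complex.Im z <= d].

(* det (U z - Id) = 0, where the Fredholm determinant makes sense for the     *)
(* trace class perturbation Id - U z of the identity.                         *)
Definition resonance (Y0 : \bar R) (H : hilbertType R)
    (U : R[i] -> {linear H -> H}) : set R[i] :=
  [set z | half_plane Y0 z /\ is_fredholm_det (fun x => x - U z x) 0].

Definition multiplicity (H : hilbertType R) (U : R[i] -> {linear H -> H})
    (z : R[i]) : \bar R :=
  dim_ker (fun x => U z x - x).

Definition resonance_count (Y0 : \bar R) (H : hilbertType R)
    (U : R[i] -> {linear H -> H}) (Omega : set R[i]) : \bar R :=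
  \esum_(z in Omega `&` resonance Y0 U) multiplicity U z.

(* Below, the constants depending on a compact set are functions of that set, *)
(* and are parameters, so that statements can be uniform over all families    *)
(* sharing the same constants.                                                *)

Record hypothesis1 (Y0 : \bar R) (Y1 : R) (C0 C0' C1 : set R[i] -> R)
    (H : nat -> hilbertType R)
    (U : forall N, R[i] -> {linear H N -> H N}) : Prop := Hypothesis1 {
  U_trace_class : forall N z, half_plane Y0 z -> trace_class (U N z) ;
  U_holomorphic : forall N z, half_plane Y0 z -> holomorphic_at (U N) z ;
  U_no_resonance_above : forall N z, 0 < complex.Im z -> ~ resonance Y0 (U N) z ;
  U_inverse_above : forall K, compact K ->
    K `<=` half_plane Y0 `&` [set z | 0 < complex.Im z] ->
    0 < C0 K /\ forall N z, K z ->
      inverse_norm_le (fun x => x - U N z x) (C0 K / `|complex.Im z|) ;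
  Y1_gt0 : 0 < Y1 ;
  U_no_resonance_below : forall N z, complex.Im z <= - Y1 ->
    ~ resonance Y0 (U N) z ;
  U_inverse_below : forall K, compact K ->
    K `<=` [set z | complex.Im z <= - Y1] ->
    0 < C0' K /\ forall N z, K z ->
      inverse_norm_le (fun x => x - U N z x) (C0' K) ;
  U_bounded : forall K, compact K -> K `<=` half_plane Y0 ->
    0 < C1 K /\ forall N z, K z -> (opnorm (U N z) <= (C1 K)%:E)%E
}.

Record hypothesis2 (Y0 : \bar R) (c Cg : set R[i] -> R)
    (H : nat -> hilbertType R)
    (U Ut : forall N, R[i] -> {linear H N -> H N})
    (gamma : nat -> R) : Prop := Hypothesis2 {
  Ut_bounded : forall N z, half_plane Y0 z -> bounded_op (Ut N z) ;
  Ut_invertible : forall N z, half_plane Y0 z ->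
    exists V : {linear H N -> H N}, inverse_op (Ut N z) V ;
  Ut_holomorphic : forall N z, half_plane Y0 z -> holomorphic_at (Ut N) z ;
  Ut_contraction : forall K, compact K -> K `<=` half_plane Y0 ->
    0 < c K /\ forall N z, K z ->
      (0 < complex.Im z ->
        (opnorm (Ut N z) <= ((1 + c K * complex.Im z)^-1)%:E)%E) /\
      (complex.Im z < 0 ->
        inverse_norm_le (Ut N z) (1 + c K * `|complex.Im z|)^-1) ;
  gamma_gt0 : forall N, 0 < gamma N ;
  U_Ut_trace_norm : forall K, compact K -> K `<=` half_plane Y0 ->
    forall N z, K z ->
      (trace_norm (fun x => (U N z x - Ut N z x)%R) <= (Cg K * gamma N)%:E)%E
}.

End resonances.

(* Main.v *)
(* For Im z < 0 let W = (Id - Ut(z))^-1 and F(z) = W (Id - U(z)), which is the *)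
(* identity minus W (U(z) - Ut(z)). Given finitely many resonances, let e be an *)
(* orthonormal basis of the span of their kernels and f one of the image of    *)
(* that span under F(c), where c lies below -Y1. The function                  *)
(* g(z) = det <F(z) e_i, f_l> vanishes at each resonance to the order of its    *)
(* multiplicity. Bounding determinants by trace norms, with |W| = O(1 / delta) *)
(* for Im z <= - delta / 2, gives |g| <= exp(O(gamma / delta)) and             *)
(* |g(c)| >= exp(- O(gamma)). A Jensen type inequality on one large square     *)
(* with top edge Im z = - delta / 2 and centre c, where each zero costs a      *)
(* factor 1 - O(delta), then bounds the number of resonances by                *)
(* O(gamma / delta^2); moreover delta <= a3 unless the rectangle is empty.      *)
From HB Require Import structures.
Require Import Defs.
From mathcomp Require Import all_boot all_order all_algebra finmap complex.
From mathcomp Require Import all_classical all_reals all_analysis.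
From mathcomp Require Import perm ring lra.

Set Implicit Arguments.
Unset Strict Implicit.
Unset Printing Implicit Defensive.

Import Order.TTheory GRing.Theory Num.Theory numFieldNormedType.Exports.

Local Open Scope classical_set_scope.
Local Open Scope ring_scope.
Local Open Scope complex_scope.

(** Below the real axis Id - Ut(z) is invertible with inverse W(z) = O(1 / |Im z|), by a Neumann
    series in the contraction Ut(z)^-1 ([resolvent]). Hence F(z) = W(z) (Id - U(z)) has the same
    kernel as Id - U(z) and differs from the identity by W(z) (U(z) - Ut(z)), of trace norm O(gamma
    / delta) for Im z <= - delta / 4. Such a family is controlled by a scalar holomorphic function
    of size exp(O(gamma / delta)), and a Jensen inequality turns size into a count of zeros.

    The scalar function is the determinant of a compression of F to finitely many vectors.
    [trace_norm_pairing], a duality between trace norm and operator norm, and Schur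
    triangularisation bound it independently of the dimension ([det_perturbation_le]). It vanishes
    at each resonance to the order of the multiplicity ([det_vanishing]). At a centre below - Y1 the
    same bound, applied to the inverse matrix, bounds it from below. [zero_count_le] combines these
    facts with [jensen_square], whose analytic input is [goursat] and the maximum principle
    [center_le_boundary], both obtained from Riemann sums on squares.

    The zeros lie at depth at least delta / 2 under the top edge of a square of fixed size, so n
    zeros satisfy n delta = O(gamma / delta), that is n = O(gamma / delta^2). As delta <= a3 when
    the rectangle is not empty, a factor sqrt a3 gives the exponent 5/2 ([resonance_bound]). A
    bounded Omega whose closure misses the real axis stays at a fixed distance from it, so a
    constant delta serves there. *)

Section nrm.
Context {R : realType}.

(** * Real-valued norms and complex differentiability *)

Definition nrm (V : normedModType R[i]) (x : V) : R := complex.Re `|x|.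

Section normed_module.
Context {V : normedModType R[i]}.
Implicit Types x y : V.

Lemma normr_nrm x : `|x| = (nrm x)%:C.
Proof. by rewrite /nrm RRe_real// normr_real. Qed.

Lemma nrm_ge0 x : 0 <= nrm x.
Proof. by rewrite -lecR -normr_nrm normr_ge0. Qed.

Lemma ler_nrmD x y : nrm (x + y) <= nrm x + nrm y.
Proof. by rewrite -lecR rmorphD/= -!normr_nrm ler_normD. Qed.

Lemma nrm0 : nrm (0 : V) = 0.
Proof. by rewrite /nrm normr0. Qed.

Lemma nrmN x : nrm (- x) = nrm x.
Proof. by rewrite /nrm normrN. Qed.

Lemma nrmBC x y : nrm (x - y) = nrm (y - x).
Proof. by rewrite /nrm distrC. Qed.

Lemma nrm0_eq0 x : nrm x = 0 -> x = 0.
Proof. by move=> x0; apply/eqP; rewrite -normr_eq0 normr_nrm x0. Qed.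

Lemma nrm_gt0 x : (0 < nrm x) = (x != 0).
Proof. by rewrite -ltcR -normr_nrm normr_gt0. Qed.

Lemma ler_nrmB x y : nrm (x - y) <= nrm x + nrm y.
Proof. by rewrite -(nrmN y) ler_nrmD. Qed.

Lemma ler_nrm_sum (I : Type) (r : seq I) (P : pred I) (F : I -> V) :
  nrm (\sum_(i <- r | P i) F i) <= \sum_(i <- r | P i) nrm (F i).
Proof.
by rewrite -lecR -normr_nrm rmorph_sum/= (le_trans (ler_norm_sum _ _ _))//
  le_eqVlt (eq_bigr _ (fun i _ => normr_nrm (F i))) eqxx.
Qed.

Lemma nrmZ (a : R[i]) x : nrm (a *: x) = nrm a * nrm x.
Proof. by apply: complexI; rewrite rmorphM/= -!normr_nrm normrZ. Qed.

End normed_module.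

Implicit Types z w : R[i].

Lemma nrmM z w : nrm (z * w) = nrm z * nrm w.
Proof. by apply: complexI; rewrite rmorphM/= -!normr_nrm normrM. Qed.

Lemma nrm1 : nrm (1 : R[i]) = 1.
Proof. by rewrite /nrm normr1. Qed.

Lemma nrmX z n : nrm (z ^+ n) = nrm z ^+ n.
Proof. by elim: n => [|n IH]; rewrite ?nrm1// !exprS nrmM IH. Qed.

Lemma nrmV z : nrm z^-1 = (nrm z)^-1.
Proof. by apply: complexI; rewrite fmorphV/= -!normr_nrm normfV. Qed.

Lemma nrm_prod (I : Type) (r : seq I) (P : pred I) (F : I -> R[i]) :
  nrm (\prod_(i <- r | P i) F i) = \prod_(i <- r | P i) nrm (F i).
Proof. by rewrite (big_morph _ nrmM nrm1). Qed.

Lemma nrm_real (x : R) : nrm x%:C = `|x|.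
Proof. by apply: complexI; rewrite -normr_nrm normc_def/= expr0n addr0 sqrtr_sqr. Qed.

Lemma nrmi : nrm ('i : R[i]) = 1.
Proof.
by apply: complexI; rewrite -normr_nrm normc_def/= expr0n add0r expr1n sqrtr1.
Qed.

Lemma nrm_conj z : nrm (Num.conj z) = nrm z.
Proof. by rewrite /nrm norm_conjC. Qed.

Lemma sqr_nrm z : nrm z ^+ 2 = complex.Re z ^+ 2 + complex.Im z ^+ 2.
Proof. by apply: complexI; rewrite rmorphXn/= -normr_nrm add_Re2_Im2. Qed.

Lemma Re_le_nrm z : `|complex.Re z| <= nrm z.
Proof. by rewrite -lecR -normr_nrm normc_ge_Re. Qed.

Lemma Im_le_nrm z : `|complex.Im z| <= nrm z.
Proof.
rewrite -(@ler_pXn2r _ 2)// ?nnegrE ?nrm_ge0//.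
by rewrite sqr_nrm real_normK ?num_real// lerDr sqr_ge0.
Qed.

Lemma nrm_le_ReIm z : nrm z <= `|complex.Re z| + `|complex.Im z|.
Proof.
rewrite [in leLHS](complexE z) (le_trans (ler_nrmD _ _))//.
by rewrite nrmM nrmi mul1r !nrm_real.
Qed.

Lemma nbhs_nrmP (V : normedModType R[i]) (x : V) (P : set V) :
  nbhs x P <-> exists2 d : R, 0 < d & forall y, nrm (y - x) < d -> P y.
Proof.
split=> [/nbhs_normP[d /= d0 dP]|[d d0 dP]].
  have dr : d = (complex.Re d)%:C by rewrite RRe_real// gtr0_real.
  exists (complex.Re d); first by rewrite -ltcR -dr.
  by move=> y yx; apply: dP; rewrite /= distrC normr_nrm dr ltcR.
apply/nbhs_normP; exists d%:C => /=; first by rewrite ltcR.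
by move=> y /=; rewrite distrC normr_nrm ltcR; exact: dP.
Qed.

(** [R[i]] is normed over itself, so [differentiable] is complex differentiability; real radii and
    errors suit the estimates below. *)
Lemma differentiable_nrmP (f : R[i] -> R[i]) z : differentiable f z <->
  exists a : R[i], forall e : R, 0 < e -> exists2 d : R, 0 < d &
    forall w, nrm (w - z) < d -> nrm (f w - f z - a * (w - z)) <= e * nrm (w - z).
Proof.
rewrite -derivable1_diffP; split.
  move=> /cvg_ex[/= a fa]; exists a => e e0.
  have /cvgrPdist_le/(_ e%:C) := fa; rewrite ltcR => /(_ e0).
  move=> /nbhs_nrmP[d d0 dP]; exists d => // w wz.
  have [->|nwz] := eqVneq w z; first by rewrite !subrr mulr0 subrr nrm0 mulr0.
  have := dP (w - z); rewrite subr0 subr_eq0 => /(_ wz nwz).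
  rewrite normr_nrm lecR /= /GRing.scale/= mulr1 subrK => H.
  have -> : f w - f z - a * (w - z) = - ((w - z) * (a - (w - z)^-1 * (f w - f z))).
    have : w - z != 0 by rewrite subr_eq0.
    by move=> ?; field.
  by rewrite nrmN nrmM mulrC ler_wpM2r ?nrm_ge0.
move=> [a fa]; apply/cvg_ex; exists a; apply/cvgrPdist_le => e e0.
have er : e = (complex.Re e)%:C by rewrite RRe_real// gtr0_real.
have [|d d0 dP] := fa (complex.Re e); first by rewrite -ltcR -er.
apply/nbhs_nrmP; exists d => // w; rewrite subr0 => wd w0.
rewrite normr_nrm er lecR /= /GRing.scale/= mulr1.
have := dP (w + z); rewrite addrK => /(_ wd) H.
have -> : a - w^-1 * (f (w + z) - f z) = - (w^-1 * (f (w + z) - f z - a * w)).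
  by have w0' : w != 0 := w0; field.
by rewrite nrmN nrmM nrmV mulrC ler_pdivrMr ?nrm_gt0.
Qed.

Lemma differentiable_nrm_lipschitz (f : R[i] -> R[i]) z : differentiable f z ->
  exists2 L : R, 0 < L & exists2 d : R, 0 < d &
    forall w, nrm (w - z) < d -> nrm (f w - f z) <= L * nrm (w - z).
Proof.
move=> /differentiable_nrmP[a fa]; exists (1 + nrm a).
  by rewrite ltr_wpDr ?nrm_ge0.
have [d d0 dP] := fa 1 ltr01; exists d => // w /dP H.
rewrite -(subrK (a * (w - z)) (f w - f z)) (le_trans (ler_nrmD _ _))//.
by rewrite nrmM mulrDl lerD.
Qed.

Lemma differentiable_eq (f g : R[i] -> R[i]) z : f =1 g ->
  differentiable f z -> differentiable g z.
Proof. by move=> fg; rewrite (_ : f = g)//; apply/funext. Qed.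

Lemma differentiable_prodr (I : Type) (r : seq I) (P : pred I)
    (F : I -> R[i] -> R[i]) z :
  (forall i, P i -> differentiable (F i) z) ->
  differentiable (fun w => \prod_(i <- r | P i) F i w) z.
Proof.
move=> dF; elim: r => [|i r IH].
  apply: (@differentiable_eq (cst 1)) => [w|]; first by rewrite big_nil.
  exact: differentiable_cst.
have [Pi|nPi] := boolP (P i); last first.
  by apply: differentiable_eq IH => w; rewrite big_cons (negbTE nPi).
by apply: differentiable_eq (differentiableM (dF _ Pi) IH) => w;
  rewrite big_cons Pi.
Qed.

Lemma differentiable_sumr (I : Type) (r : seq I) (P : pred I)
    (F : I -> R[i] -> R[i]) z :
  (forall i, P i -> differentiable (F i) z) ->
  differentiable (fun w => \sum_(i <- r | P i) F i w) z.
Proof.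
move=> dF; elim: r => [|i r IH].
  apply: (@differentiable_eq (cst 0)) => [w|]; first by rewrite big_nil.
  exact: differentiable_cst.
have [Pi|nPi] := boolP (P i); last first.
  by apply: differentiable_eq IH => w; rewrite big_cons (negbTE nPi).
by apply: differentiable_eq (differentiableD (dF _ Pi) IH) => w;
  rewrite big_cons Pi.
Qed.

Lemma differentiable_det n (A : R[i] -> 'M[R[i]]_n) z :
  (forall i j, differentiable ((fun w => A w i j) : R[i] -> R[i]) z) ->
  differentiable ((fun w => \det (A w)) : R[i] -> R[i]) z.
Proof.
have E : (fun w => \det (A w)) = (fun w : R[i] => \sum_(s : 'S_n)
  (cst ((-1) ^+ s : R[i]) * (fun w : R[i] => \prod_i A w i (s i))) w : R[i]).
  by apply/funext => w.
move=> dA; rewrite E; apply: differentiable_sumr => s _.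
by apply: differentiableM; [exact: differentiable_cst|exact: differentiable_prodr].
Qed.

End nrm.

(** * Riemann sums along squares, and bisection *)

Section square_sums.
Context {R : realType}.
Implicit Types (f g : R[i] -> R[i]) (p v w z : R[i]) (l : R).

Definition lsum f (n : nat) p v : R[i] :=
  v / 2 ^+ n * \sum_(k < 2 ^ n) f (p + v / 2 ^+ n * k%:R).

(* Left Riemann sums of the integral of f along the boundary of the square    *)
(* with lower left corner p and side v. Bisection is exact for these sums, and *)
(* they vanish on affine functions, so that no integral is needed.            *)
Definition sqsum f (n : nat) p v : R[i] :=
  lsum f n p v + lsum f n (p + v) ('i * v)
  - lsum f n (p + 'i * v) v - lsum f n p ('i * v).

Lemma expr2C_neq0 (n : nat) : (2 : R[i]) ^+ n != 0.
Proof. by rewrite expf_neq0 ?pnatr_eq0. Qed.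

Lemma lsumS f n p v :
  lsum f n.+1 p v = lsum f n p (v / 2) + lsum f n (p + v / 2) (v / 2).
Proof.
have n0 := expr2C_neq0 n.
have h : v / 2 ^+ n.+1 = v / 2 / 2 ^+ n by rewrite exprS; field.
rewrite /lsum -mulrDr h; congr (_ * _).
have -> : (2 ^ n.+1 = 2 ^ n + 2 ^ n)%N by rewrite expnS mul2n addnn.
rewrite big_split_ord /=; congr (_ + _); apply: eq_bigr => k _.
by rewrite natrD natrX; congr f; field.
Qed.

Lemma sqsumS f n p v (h := v / 2) : sqsum f n.+1 p v =
  sqsum f n p h + sqsum f n (p + h) h + sqsum f n (p + 'i * h) h
  + sqsum f n (p + h + 'i * h) h.
Proof.
rewrite /sqsum !lsumS -/h.
have -> : 'i * v / 2 = 'i * h by rewrite /h mulrA.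
have -> : p + 'i * v + h = p + h + 'i * h + 'i * h by rewrite /h; field.
have -> : p + h + h = p + v by rewrite /h; field.
have -> : p + h + 'i * h + h = p + v + 'i * h by rewrite /h; field.
have -> : p + 'i * h + h = p + h + 'i * h by ring.
have -> : p + 'i * h + 'i * h = p + 'i * v by rewrite /h; field.
by ring.
Qed.

Lemma lsumD f g n p v : lsum (f \+ g) n p v = lsum f n p v + lsum g n p v.
Proof. by rewrite /lsum big_split mulrDr. Qed.

Lemma sqsumD f g n p v : sqsum (f \+ g) n p v = sqsum f n p v + sqsum g n p v.
Proof. by rewrite /sqsum !lsumD; ring. Qed.

Lemma lsumZ (a : R[i]) f n p v : lsum (fun w => a * f w) n p v = a * lsum f n p v.
Proof. by rewrite /lsum -mulr_sumr; ring. Qed.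

Lemma sqsumZ (a : R[i]) f n p v :
  sqsum (fun w => a * f w) n p v = a * sqsum f n p v.
Proof. by rewrite /sqsum !lsumZ; ring. Qed.

(** The left sum over an edge from q with side u is u (a + b q) plus a term that depends only on u.
    Opposite edges have the same u and opposite signs, so these terms cancel exactly at every level
    n. *)
Lemma sqsum_affine (a b : R[i]) n p v : sqsum (fun w => a + b * w) n p v = 0.
Proof.
have n0 := expr2C_neq0 n.
have E q u : lsum (fun w => a + b * w) n q u =
    u * (a + b * q) + b * u ^+ 2 / (2 ^+ n) ^+ 2 * \sum_(k < 2 ^ n) k%:R.
  rewrite /lsum (eq_bigr (fun k : 'I_(2 ^ n) =>
    (a + b * q) + b * (u / 2 ^+ n) * k%:R)); last by move=> k _; ring.
  by rewrite big_split/= sumr_const card_ord -mulr_sumr -(mulr_natl (a + b * q)) natrX; field.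
by rewrite /sqsum !E; have : 'i ^+ 2 = -1 :> R[i] := sqr_i R; move=> ii; ring.
Qed.

Definition square p l : set R[i] :=
  [set w | complex.Re p <= complex.Re w <= complex.Re p + l /\
           complex.Im p <= complex.Im w <= complex.Im p + l].

Definition square_boundary p l : set R[i] :=
  [set w | square p l w /\
    [\/ complex.Re w = complex.Re p, complex.Re w = complex.Re p + l,
        complex.Im w = complex.Im p | complex.Im w = complex.Im p + l]].

Lemma lsum_real f n p l :
  lsum f n p l%:C = (l / 2 ^+ n)%:C * \sum_(k < 2 ^ n) f (p + (l * (k%:R / 2 ^+ n))%:C).
Proof.
rewrite /lsum; congr (_ * _); first by rewrite fmorph_div/= rmorphXn/= rmorph_nat.
apply: eq_bigr => k _; congr (f (_ + _)).
by rewrite mulrAC -mulrA rmorphM/= fmorph_div/= rmorphXn/= !rmorph_nat.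
Qed.

Lemma lsum_imag f n p l : lsum f n p ('i * l%:C) =
  'i * (l / 2 ^+ n)%:C * \sum_(k < 2 ^ n) f (p + 'i * (l * (k%:R / 2 ^+ n))%:C).
Proof.
have -> : lsum f n p ('i * l%:C) = 'i * (l%:C / 2 ^+ n) *
    \sum_(k < 2 ^ n) f (p + 'i * (l%:C * (k%:R / 2 ^+ n))).
  rewrite /lsum mulrA; congr (_ * _); apply: eq_bigr => k _.
  by congr (f (_ + _)); rewrite -!mulrA [_^-1 * _]mulrC.
rewrite fmorph_div/= rmorphXn/= rmorph_nat; congr (_ * _).
apply: eq_bigr => k _.
by rewrite rmorphM/= fmorph_div/= rmorphXn/= !rmorph_nat.
Qed.

Lemma dyadic_ge0_le1 n (k : 'I_(2 ^ n)) : 0 <= (k%:R / 2 ^+ n : R) <= 1.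
Proof.
rewrite divr_ge0 ?exprn_ge0//= ler_pdivrMr ?exprn_gt0// mul1r -natrX ler_nat.
exact: ltnW.
Qed.

Lemma nrm_sqsum_le f n p l (B : R) : 0 <= l ->
  (forall w, square_boundary p l w -> nrm (f w) <= B) ->
  nrm (sqsum f n p l%:C) <= 4 * l * B.
Proof.
move=> l0 fB; have n0 : (2 : R) ^+ n != 0 by rewrite expf_neq0 ?pnatr_eq0.
have ln : 0 <= l / 2 ^+ n by rewrite divr_ge0 ?exprn_ge0.
have S (F : 'I_(2 ^ n) -> R[i]) : (forall k, nrm (F k) <= B) ->
    nrm ((l / 2 ^+ n)%:C * \sum_(k < 2 ^ n) F k) <= l * B.
  move=> FB; rewrite nrmM nrm_real ger0_norm//.
  apply: (@le_trans _ _ (l / 2 ^+ n * \sum_(k < 2 ^ n) B)).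
    by rewrite ler_wpM2l// (le_trans (ler_nrm_sum _ _ _))// ler_sum.
  by rewrite sumr_const card_ord -(mulr_natl B) natrX mulrA divfK.
have lk k : 0 <= l * ((k : 'I_(2 ^ n))%:R / 2 ^+ n) <= l.
  by have /andP[? ?] := dyadic_ge0_le1 k; rewrite mulr_ge0//= ler_piMr.
rewrite /sqsum !lsum_real !lsum_imag -!mulrA.
have T (a b c d : R[i]) : nrm (a + 'i * b - c - 'i * d) <= nrm a + nrm b + nrm c + nrm d.
  rewrite (le_trans (ler_nrmB _ _))// nrmM nrmi mul1r lerD2r.
  rewrite (le_trans (ler_nrmB _ _))// lerD2r.
  by rewrite (le_trans (ler_nrmD _ _))// nrmM nrmi mul1r.
apply: (le_trans (T _ _ _ _)).
have -> : 4 * (l * B) = l * B + l * B + l * B + l * B by ring.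
have sum4 (a b c d x : R) : a <= x -> b <= x -> c <= x -> d <= x ->
  a + b + c + d <= x + x + x + x by lra.
by apply: sum4; apply: S => k; apply: fB; have := lk k; case: p => a b /andP[? ?];
  rewrite /square_boundary /square /= ?(mul0r, mul1r, addr0, add0r, subr0, sub0r, oppr0, mulr0);
  (split; [split; apply/andP; split; lra|]);
  [apply: Or43|apply: Or42|apply: Or44|apply: Or41]; lra.
Qed.

(** If P failed on the square, it would fail on one of its quarters, hence on nested squares
    shrinking to a point, where the local hypothesis contradicts the failure. *)
Lemma bisection (P : R[i] -> R -> Prop) p l : 0 < l ->
  (forall q m (h := m / 2), 0 < m -> P q h -> P (q + h%:C) h -> P (q + 'i * h%:C) h ->
    P (q + h%:C + 'i * h%:C) h -> P q m) ->
  (forall z, square p l z -> exists2 d, 0 < d & forall q m,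
    0 < m < d -> square q m z -> square q m `<=` square p l -> P q m) ->
  P p l.
Proof.
move=> l0 sub loc; apply: contrapT => nP.
pose len n := l / 2 ^+ n.
have len0 n : 0 < len n by rewrite divr_gt0 ?exprn_gt0.
have lenS n : len n.+1 = len n / 2.
  by rewrite /len exprS invfM mulrCA mulrC.
have /choice[next nextP] : forall x : R[i] * R, exists y : R[i],
    0 < x.2 -> ~ P x.1 x.2 -> ~ P y (x.2 / 2) /\ square y (x.2 / 2) `<=` square x.1 x.2.
  move=> [q m] /=; have [m0|] := ltP 0 m; last by exists 0.
  have [Pq|nPq] := pselect (P q m); first by exists 0.
  have : exists2 y, ~ P y (m / 2) & y \in [:: q; q + (m / 2)%:C;
      q + 'i * (m / 2)%:C; q + (m / 2)%:C + 'i * (m / 2)%:C].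
    apply: contrapT => H; apply: nPq; apply: sub => //; apply: contrapT => nP';
    by apply: H; eexists; [exact: nP'|rewrite !inE eqxx ?orbT].
  move=> [y nPy yq]; exists y => _ _; split=> // w.
  move: yq; rewrite !inE => /or4P[] /eqP ->; case: q {nPq nPy} => a b;
    rewrite /square /= ?(mul0r, mul1r, addr0, add0r, subr0, sub0r, oppr0, mulr0);
    move=> [/andP[? ?] /andP[? ?]]; split; apply/andP; split; lra.
pose q := fix q n := if n is k.+1 then next (q k, len k) else p.
have qP n : ~ P (q n) (len n) /\ square (q n) (len n) `<=` square p l.
  elim: n => [|n [nPn sn]]; first by rewrite /len expr0 divr1; split.
  have [] := nextP (q n, len n) (len0 n) nPn; rewrite -lenS => ? sn1.
  by split => //; apply: subset_trans sn.
have qS n : square (q n.+1) (len n.+1) `<=` square (q n) (len n).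
  have [] := nextP (q n, len n) (len0 n) (qP n).1.
  by rewrite -lenS.
have qm n k : square (q (n + k)%N) (len (n + k)%N) `<=` square (q n) (len n).
  elim: k => [|k IH]; first by rewrite addn0.
  by rewrite addnS; apply: subset_trans IH.
have corner n : square (q n) (len n) (q n).
  by have := len0 n; split; apply/andP; split; lra.
have corner' n : square (q n) (len n) (q n + (len n)%:C + 'i * (len n)%:C).
  have := len0 n; rewrite /square; case: (q n) => a b /=.
  by split; apply/andP; split; lra.
(* No lower left corner passes an upper right one, so the suprema of the coordinates of the corners
   define a point common to all the squares. *)
have cross n k : complex.Re (q k) <= complex.Re (q n) + len n /\
                 complex.Im (q k) <= complex.Im (q n) + len n.
  have [nk|/ltnW kn] := leqP n k.
    have /qm := corner (n + (k - n))%N; rewrite subnKC// /square.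
    by move=> [/andP[_ ?] /andP[_ ?]].
  have /qm := corner' (k + (n - k))%N; rewrite subnKC// /square.
  case: (q n) => a b /= [/andP[? _] /andP[? _]]; split; lra.
have ex (u : R[i] -> R) : (forall n k, u (q k) <= u (q n) + len n) ->
    exists x, forall n, u (q n) <= x <= u (q n) + len n.
  move=> uq; exists (sup (range (u \o q))) => n.
  have B : has_sup (range (u \o q)).
    split; first by exists (u (q 0%N)), 0%N.
    by exists (u (q 0%N) + len 0%N) => _ [k _ <-] /=; exact: (uq 0%N k).
  apply/andP; split; first by apply: sup_upper_bound => //; exists n.
  by apply: ge_sup; [case: B|move=> _ [k _ <-] /=; exact: (uq n k)].
have [x xP] := ex (@complex.Re R) (fun n k => (cross n k).1).
have [y yP] := ex (@complex.Im R) (fun n k => (cross n k).2).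
have zq n : square (q n) (len n) (x +i* y) by split => /=.
have [d d0 dP] := loc _ ((qP 0%N).2 _ (zq 0%N)).
have [n nd] : exists n, len n < d.
  have := upper_nthrootP (leqnn (Num.Def.archi_bound (l / d))).
  set n := Num.Def.archi_bound _ => ln; exists n; move: ln.
  by rewrite /len ltr_pdivrMr ?exprn_gt0// mulrC -ltr_pdivrMr.
apply: (qP n).1; apply: dP => //; [by rewrite len0 nd|exact: (qP n).2].
Qed.

End square_sums.

(** * Goursat's theorem with finitely many exceptional points *)

Section goursat.
Context {R : realType}.
Implicit Types (f g h : R[i] -> R[i]) (p v w z : R[i]) (l : R) (E : seq R[i]).

(* Twice the indicator of the interval [a, a + l], with value 1 at the end     *)
(* points: it is additive under bisection and positive on the closed interval. *)
Definition interval_weight (a l x : R) : R := Num.sg (a + l - x) - Num.sg (a - x).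

(** An error budget for the exceptional points: additive under bisection, and at least 1 on every
    closed square of positive side that contains one of them. *)
Definition square_weight E p l : R :=
  \sum_(x <- E) interval_weight (complex.Re p) l (complex.Re x) *
                interval_weight (complex.Im p) l (complex.Im x).

Lemma interval_weight_ge0 a l x : 0 <= l -> 0 <= interval_weight a l x.
Proof.
move=> l0; rewrite /interval_weight.
by case: sgrP => ?; case: sgrP => ?; lra.
Qed.

Lemma interval_weight_ge1 a l x : 0 < l -> a <= x <= a + l -> 1 <= interval_weight a l x.
Proof.
move=> l0 /andP[? ?]; rewrite /interval_weight.
by case: sgrP => ?; case: sgrP => ?; lra.
Qed.

Lemma interval_weight_half a l x : interval_weight a l x =
  interval_weight a (l / 2) x + interval_weight (a + l / 2) (l / 2) x.
Proof.
have e : a + l / 2 + l / 2 = a + l by field.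
by rewrite /interval_weight e; ring.
Qed.

Lemma square_weight_ge0 E p l : 0 <= l -> 0 <= square_weight E p l.
Proof. by move=> l0; apply: sumr_ge0 => x _; rewrite mulr_ge0// interval_weight_ge0. Qed.

Lemma square_weight_ge1 E p l x : 0 < l -> x \in E -> square p l x ->
  1 <= square_weight E p l.
Proof.
move=> l0; have l0' := ltW l0; rewrite /square_weight; elim: E => // y E IH.
rewrite inE big_cons.
have W w : 0 <= interval_weight (complex.Re p) l (complex.Re w) *
    interval_weight (complex.Im p) l (complex.Im w).
  by rewrite mulr_ge0// interval_weight_ge0.
have [<- _ [px py]|_ /= xE px] := eqVneq x y.
  rewrite -[leLHS]addr0 lerD ?sumr_ge0//.
  by rewrite -[leLHS]mulr1 ler_pM// interval_weight_ge1.
by rewrite -[leLHS]add0r lerD// IH.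
Qed.

Lemma square_weight_half E p l (h := l / 2) : square_weight E p l =
  square_weight E p h + square_weight E (p + h%:C) h +
  square_weight E (p + 'i * h%:C) h + square_weight E (p + h%:C + 'i * h%:C) h.
Proof.
rewrite /square_weight -!big_split; apply: eq_bigr => x _.
case: p => a b /=; rewrite ?(mul0r, mul1r, addr0, add0r, subr0, sub0r, oppr0, mulr0).
by rewrite !(interval_weight_half _ l) /h; ring.
Qed.

Lemma square_diameter p l w z : square p l w -> square p l z -> nrm (w - z) <= 2 * l.
Proof.
move=> [/andP[? ?] /andP[? ?]] [/andP[? ?] /andP[? ?]].
apply: (le_trans (nrm_le_ReIm _)); rewrite !raddfB/= mulr2n mulrDl mul1r.
by apply: lerD; rewrite ler_norml; apply/andP; split; lra.
Qed.

(** Bisection propagates the bound r (area + weight). On a small square near a regular point the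
    affine part drops out and leaves o(area). Near an exceptional point boundedness alone makes the
    sum small, and the weight, at least 1 there, pays for it. *)
Lemma goursat f p l E : 0 < l ->
  (forall z, square p l z -> z \notin E -> differentiable f z) ->
  (forall z, square p l z -> z \in E -> exists B : R, exists2 d : R, 0 < d &
     forall w, nrm (w - z) < d -> nrm (f w) <= B) ->
  forall e : R, 0 < e -> exists n0, forall n, (n0 <= n)%N ->
    nrm (sqsum f n p l%:C) <= e.
Proof.
move=> l0 fd fb e e0.
pose W := l ^+ 2 + square_weight E p l + 1.
have W0 : 0 < W by rewrite /W ltr_wpDl// addr_ge0 ?sqr_ge0// square_weight_ge0// ltW.
pose r := e / W; have r0 : 0 < r by rewrite divr_gt0.
pose P q m := exists n0, forall n, (n0 <= n)%N ->
  nrm (sqsum f n q m%:C) <= r * (m ^+ 2 + square_weight E q m).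
suff [n0 n0P] : P p l.
  exists n0 => n /n0P /le_trans; apply.
  by rewrite /r mulrAC ler_pdivrMr// ler_wpM2l ?ltW// /W; lra.
apply: bisection => // [q m h m0 [n1 P1] [n2 P2] [n3 P3] [n4 P4]|z pz].
  exists (maxn (maxn n1 n2) (maxn n3 n4)).+1 => -[//|n].
  rewrite ltnS !geq_max => /andP[/andP[? ?] /andP[? ?]].
  have hE : m%:C / 2 = h%:C by rewrite /h fmorph_div/= rmorph_nat.
  rewrite sqsumS hE square_weight_half -/h.
  apply: (le_trans (ler_nrmD _ _)); apply: (le_trans (lerD (ler_nrmD _ _) (lexx _))).
  apply: (le_trans (lerD (lerD (ler_nrmD _ _) (lexx _)) (lexx _))).
  have -> : m ^+ 2 = h ^+ 2 + h ^+ 2 + h ^+ 2 + h ^+ 2 by rewrite /h; field.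
  have {P1} := P1 n; have {P2} := P2 n; have {P3} := P3 n; have {P4} := P4 n.
  by do 4![move=> /(_ ltac:(done)) ?]; lra.
have [zE|zE] := boolP (z \in E).
  have [B [d d0 dB]] := fb z pz zE.
  have B0 : 0 <= B by apply: le_trans (dB z _); rewrite ?nrm_ge0// subrr nrm0.
  exists (Num.min (d / 2) (r / (4 * (B + 1)))).
    by rewrite lt_min !divr_gt0// mulr_gt0// ltr_wpDl.
  move=> q m /andP[m0]; rewrite lt_min => /andP[md mr] qz _; exists 0%N => n _.
  apply: (le_trans (nrm_sqsum_le (B := B) _ (ltW m0) _)).
    by move=> w [/square_diameter/(_ qz) wz _]; apply: dB; lra.
  apply: (@le_trans _ _ r).
    by move: mr; rewrite ltr_pdivlMr ?mulr_gt0 ?ltr_wpDl//; nra.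
  apply: ler_peMr; first exact: ltW.
  rewrite -[leLHS]add0r; apply: lerD; first exact: sqr_ge0.
  exact: square_weight_ge1 m0 zE qz.
have /differentiable_nrmP[a /(_ (r / 8))] := fd z pz zE.
rewrite divr_gt0// => /(_ isT)[d d0 dP].
exists (d / 2); first by rewrite divr_gt0.
move=> q m /andP[m0 md] qz _; exists 0%N => n _.
have -> : sqsum f n q m%:C =
    sqsum (fun w => f w - f z - a * (w - z)) n q m%:C.
  rewrite -[LHS]addr0 -(sqsum_affine (a * z - f z) (- a) n q m%:C) -sqsumD.
  by congr sqsum; apply/funext => w /=; ring.
(* Two points of the square are at distance at most 2 m, and the perimeter 4 m times (r / 8) (2 m)
   is r m^2. *)
apply: (le_trans (nrm_sqsum_le (B := r / 8 * (2 * m)) _ (ltW m0) _)).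
  move=> w [/square_diameter/(_ qz) wz _]; apply: (le_trans (dP _ _)); first lra.
  by rewrite ler_wpM2l// divr_ge0// ltW.
have := square_weight_ge0 E q (ltW m0); nra.
Qed.

End goursat.


(** * The maximum principle at the centre of a square *)

Section center.
Context {R : realType}.
Implicit Types (f g h : R[i] -> R[i]) (w z c : R[i]) (s : R) (E : seq R[i]).

Definition square_corner c s : R[i] := c - s%:C - 'i * s%:C.

(** A substitute for the value 2 pi i of the integral of 1 / (w - c): on each edge the component
    that contributes is s / (u^2 + s^2) >= 1 / (2 s), over a length 2 s, so each of the four edges
    gives at least 1. *)
Lemma Im_sqsum_inv c s n : 0 < s ->
  4 <= complex.Im (sqsum (fun w => (w - c)^-1) n (square_corner c s) (2 * s)%:C).
Proof.
move=> s0; have n0 : (2 : R) ^+ n != 0 by rewrite expf_neq0 ?pnatr_eq0.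
have key (u : R) : - s <= u <= s -> (2 * s)^-1 <= s / (u ^+ 2 + s ^+ 2).
  move=> /andP[? ?]; rewrite ler_pdivlMr; last by nra.
  by rewrite mulrC ler_pdivrMr; nra.
have S (F : 'I_(2 ^ n) -> R) : (forall k, (2 * s)^-1 <= F k) ->
    1 <= 2 * s / 2 ^+ n * \sum_(k < 2 ^ n) F k.
  move=> FB; apply: (@le_trans _ _ (2 * s / 2 ^+ n * \sum_(k < 2 ^ n) (2 * s)^-1)).
    rewrite sumr_const card_ord -(mulr_natl _^-1) natrX le_eqVlt.
    by apply/orP; left; apply/eqP; field; rewrite n0 gt_eqF.
  apply: ler_wpM2l; last exact: ler_sum.
  by rewrite divr_ge0 ?exprn_ge0// mulr_ge0// ltW.
have lk k : - s <= 2 * s * ((k : 'I_(2 ^ n))%:R / 2 ^+ n) - s <= s.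
  by have /andP[? ?] := dyadic_ge0_le1 (R := R) k; apply/andP; split; nra.
rewrite /sqsum !lsum_real !lsum_imag /square_corner.
set m := 2 * s / 2 ^+ n; set S1 := \sum_(k < _) _; set S2 := \sum_(k < _) _.
set S3 := \sum_(k < _) _; set S4 := \sum_(k < _) _.
have -> : complex.Im (m%:C * S1 + 'i * m%:C * S2 - m%:C * S3 - 'i * m%:C * S4) =
    m * complex.Im S1 + m * complex.Re S2 + m * (- complex.Im S3) +
    m * (- complex.Re S4).
  by case: (S1) (S2) (S3) (S4) => ? ? [? ?] [? ?] [? ?] /=; ring.
have lra4 (a b c' d : R) : 1 <= a -> 1 <= b -> 1 <= c' -> 1 <= d -> 4 <= a + b + c' + d
  by lra.
apply: lra4; rewrite raddf_sum -?sumrN; apply: S => k;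
  rewrite (le_trans (key _ (lk k)))// le_eqVlt; apply/orP; left; apply/eqP;
  clear S1 S2 S3 S4; case: c => c1 c2 /=;
  rewrite ?(mul0r, mul1r, addr0, add0r, subr0, sub0r, oppr0, mulr0).
all: move: (k%:R / 2 ^+ n) => t.
all: have e1 x : x - s - x = - s by ring.
all: have e2 x : x - s + 2 * s - x = s by ring.
all: have e3 x : x - s + 2 * s * t - x = 2 * s * t - s by ring.
all: by rewrite ?e1 ?e2 ?e3 ?mulNr ?sqrrN ?opprK// addrC.
Qed.


Lemma nrm_sub_center_ge c s w : 0 < s -> square_boundary (square_corner c s) (2 * s) w ->
  s <= nrm (w - c).
Proof.
case: c => c1 c2 s0; rewrite /square_boundary /square /=.
have := Re_le_nrm (w - (c1 +i* c2)); have := Im_le_nrm (w - (c1 +i* c2)).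
rewrite !raddfB/= !ler_norml => /andP[? ?] /andP[? ?].
rewrite ?(mul0r, mul1r, addr0, add0r, subr0, sub0r, oppr0, mulr0).
by move=> [[/andP[? ?] /andP[? ?]]] [] ?; lra.
Qed.

(* Cauchy's formula at the centre: goursat is applied to the difference       *)
(* quotient (h w - h c) / (w - c), with c as an additional exceptional point. *)
Lemma center_le_twice_boundary h c s E (M : R) : 0 < s -> c \notin E ->
  (forall z, square (square_corner c s) (2 * s) z -> z \notin E -> differentiable h z) ->
  (forall z, square (square_corner c s) (2 * s) z -> z \in E -> exists B : R,
     exists2 d : R, 0 < d & forall w, nrm (w - z) < d -> nrm (h w) <= B) ->
  (forall w, square_boundary (square_corner c s) (2 * s) w -> nrm (h w) <= M) ->
  nrm (h c) <= 2 * M.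
Proof.
move=> s0 cE hd hb hM; have s20 : 0 < 2 * s by rewrite mulr_gt0.
have sc : square (square_corner c s) (2 * s) c.
  rewrite /square_corner; case: c {cE hd hb hM} => c1 c2; split; apply/andP => /=;
  by rewrite ?(mul0r, mul1r, addr0, add0r, subr0, sub0r, oppr0, mulr0); split; lra.
pose inv w := (w - c)^-1.
pose k w := (h w - h c) * inv w.
have dinv z : z != c -> differentiable (inv : R[i] -> R[i]) z.
  move=> zc; apply: differentiableV; last by rewrite subr_eq0.
  exact: differentiableB.
have dh : differentiable h c by apply: hd.
have I : forall e, 0 < e -> exists n0, forall n, (n0 <= n)%N ->
    nrm (sqsum k n (square_corner c s) (2 * s)%:C) <= e.
  apply: (@goursat _ k (square_corner c s) (2 * s) (c :: E) s20).
  - move=> z zQ; rewrite inE negb_or => /andP[zc zE].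
    have -> : k = (h - cst (h c)) * inv by apply/funext.
      apply: differentiableM; last exact: dinv.
    apply: differentiableB; [exact: hd|exact: differentiable_cst].
  - move=> z zQ; have [->{z zQ} _|zc] := eqVneq z c.
      have [L L0 [d d0 dL]] := differentiable_nrm_lipschitz dh.
      exists L, d => // w /dL; rewrite /k nrmM nrmV.
      have [->|wc] := eqVneq w c; first by rewrite !subrr nrm0 mul0r => _; exact: ltW.
      by rewrite -ler_pdivrMr ?nrm_gt0 ?subr_eq0.
    rewrite inE (negbTE zc) /= => /(hb _ zQ)[B [d d0 dB]].
    have zc0 : 0 < nrm (z - c) by rewrite nrm_gt0 subr_eq0.
    exists ((B + nrm (h c)) * (2 / nrm (z - c))), (Num.min d (nrm (z - c) / 2)).
      by rewrite lt_min d0 divr_gt0.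
    move=> w; rewrite lt_min => /andP[/dB hB wz]; rewrite /k nrmM.
    apply: ler_pM; rewrite ?nrm_ge0//; first by rewrite (le_trans (ler_nrmB _ _))// lerD2r.
    rewrite /inv nrmV -[leRHS]invrK lef_pV2 ?posrE ?invr_gt0 ?divr_gt0//.
      rewrite invf_div; have := ler_nrmD (z - w) (w - c); rewrite addrA subrK.
      by rewrite (nrmBC z w); lra.
    have := ler_nrmD (z - w) (w - c); rewrite addrA subrK (nrmBC z w); lra.
(* The boundary has length 8 s, and h / (w - c) is at most M / s there; this gives 8 M, against the
   factor 4 of [Im_sqsum_inv]. *)
suff: forall e, 0 < e -> 4 * nrm (h c) <= 8 * M + e.
  move=> H; rewrite -(ler_pM2l (_ : 0 < 4))// mulrA -natrM.
  by apply/ler_addgt0Pr => e /H; rewrite -[(4 * 2)%N]/8%N.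
move=> e e0; have [n0 n0P] := I e e0; have kn := n0P n0 (leqnn _).
have hk : sqsum (fun w => h w * inv w) n0 (square_corner c s) (2 * s)%:C =
    sqsum k n0 (square_corner c s) (2 * s)%:C +
    h c * sqsum inv n0 (square_corner c s) (2 * s)%:C.
  rewrite -sqsumZ -sqsumD; congr sqsum; apply/funext => w /=.
  by rewrite /k mulrBl subrK.
have I4 := Im_sqsum_inv c n0 s0.
have N4 : 4 <= nrm (sqsum inv n0 (square_corner c s) (2 * s)%:C).
  by apply: (le_trans I4); rewrite (le_trans _ (Im_le_nrm _))// ler_norm.
apply: (@le_trans _ _ (nrm (h c * sqsum inv n0 (square_corner c s) (2 * s)%:C))).
  by rewrite nrmM mulrC ler_wpM2l ?nrm_ge0.
have -> : h c * sqsum inv n0 (square_corner c s) (2 * s)%:C =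
    sqsum (fun w => h w * inv w) n0 (square_corner c s) (2 * s)%:C -
    sqsum k n0 (square_corner c s) (2 * s)%:C by rewrite hk addrC addKr.
apply: (le_trans (ler_nrmB _ _)); apply: lerD => //.
have := @nrm_sqsum_le _ (fun w => h w * inv w) n0 (square_corner c s) (2 * s) (M / s) (ltW s20).
have -> : 4 * (2 * s) * (M / s) = 8 * M by field; rewrite gt_eqF.
apply=> w wb; rewrite nrmM nrmV; apply: ler_pM; rewrite ?nrm_ge0 ?invr_ge0 ?nrm_ge0//.
  exact: hM.
by rewrite lef_pV2 ?posrE ?(lt_le_trans s0)// nrm_sub_center_ge.
Qed.

(** If x > M, Bernoulli's inequality makes (x / M)^m exceed 2 for large m. *)
Lemma expr_le_twice (x M : R) : 0 <= M -> 0 <= x ->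
  (forall m : nat, x ^+ m <= 2 * M ^+ m) -> x <= M.
Proof.
move=> M0 x0 H; rewrite leNgt; apply/negP => Mx.
have [M00|Mn0] := eqVneq M 0; first by have := H 1%N; rewrite !expr1; lra.
have Mp : 0 < M by rewrite lt_neqAle eq_sym Mn0.
have B (t : R) m : 0 <= t -> 1 + m%:R * t <= (1 + t) ^+ m.
  move=> t0; elim: m => [|m IH]; first by rewrite mul0r addr0.
  rewrite exprS -natr1; have := ler0n R m; nra.
pose t := x / M - 1; have t0 : 0 < t by rewrite subr_gt0 ltr_pdivlMr// mul1r.
pose m := Num.Def.archi_bound t^-1.
have : t^-1 < m%:R by apply: archi_boundP; rewrite invr_ge0 ltW.
rewrite -[t^-1]mul1r ltr_pdivrMr// => mt.
have := B t m (ltW t0); have -> : 1 + t = x / M by rewrite /t; ring.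
rewrite expr_div_n ler_pdivlMr ?exprn_gt0// => Bt.
have Mm : 0 < M ^+ m by rewrite exprn_gt0.
by have := H m; nra.
Qed.

(* The constant 2 of center_le_twice_boundary is removed by applying it to powers of h. *)
Lemma center_le_boundary h c s E (M : R) : 0 < s -> c \notin E -> 0 <= M ->
  (forall z, square (square_corner c s) (2 * s) z -> z \notin E -> differentiable h z) ->
  (forall z, square (square_corner c s) (2 * s) z -> z \in E -> exists B : R,
     exists2 d : R, 0 < d & forall w, nrm (w - z) < d -> nrm (h w) <= B) ->
  (forall w, square_boundary (square_corner c s) (2 * s) w -> nrm (h w) <= M) ->
  nrm (h c) <= M.
Proof.
move=> s0 cE M0 hd hb hM; apply: expr_le_twice => // [|m]; first exact: nrm_ge0.
rewrite -nrmX; apply: (center_le_twice_boundary (h := fun w => h w ^+ m) s0 cE).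
- move=> z zQ zE; case: m => [|m].
    have -> : (fun w => h w ^+ 0) = cst 1 by apply/funext.
    exact: differentiable_cst.
  have -> : (fun w => h w ^+ m.+1) = h ^+ m.+1.
    by apply/funext => w; rewrite exprfctE.
  exact/differentiableX/hd.
- move=> z zQ zE; have [B [d d0 dB]] := hb z zQ zE.
  exists (B ^+ m), d => // w /dB hB; rewrite nrmX lerXn2r ?nnegrE ?nrm_ge0//.
  exact: le_trans (nrm_ge0 _) hB.
- by move=> w /hM hwM; rewrite nrmX lerXn2r ?nnegrE ?nrm_ge0.
Qed.

End center.

(** * A Jensen inequality on squares *)

Section zeros.
Context {R : realType}.
Implicit Types (f g h : R[i] -> R[i]) (w z c : R[i]) (s : R).

(* The reflection is in the top edge of the square of centre c and half side s. *)
Definition reflect_top c s z : R[i] :=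
  complex.Re z +i* (2 * (complex.Im c + s) - complex.Im z).

(* The factors (w - z') / (w - z), with z' the reflection of z, have modulus 1 *)
(* on the top edge; on the three other edges they are smaller than at c.      *)
Lemma reflected_distance_ratio c s z w (D : R) : 0 < s -> 0 < D ->
  D <= complex.Im c + s - complex.Im z <= s / 10 ->
  `|complex.Re z - complex.Re c| <= s / 10 ->
  square_boundary (square_corner c s) (2 * s) w ->
  nrm ((w - reflect_top c s z) / (w - z)) <=
  (1 - 9 / 20 * (D / s)) * nrm ((c - reflect_top c s z) / (c - z)).
Proof.
move=> s0 D0 /andP[Du us] zc wb.
set q := 1 - _; set v := complex.Im c + s - complex.Im z in Du us.
have v0 : 0 < v by exact: lt_le_trans Du.
have t0 : 0 < v / s by rewrite divr_gt0.
have t1 : v / s <= 1 / 10 by rewrite ler_pdivrMr//; lra.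
have Dt : D / s <= v / s by rewrite ler_pM2r ?invr_gt0.
have Ds0 : 0 < D / s by rewrite divr_gt0.
have q0 : 0 < q by rewrite /q; lra.
have vs : v = v / s * s by rewrite divfK// gt_eqF.
pose X := complex.Re w - complex.Re z; pose Y := complex.Im c + s - complex.Im w.
pose X0 := complex.Re c - complex.Re z.
have wz : nrm (w - z) ^+ 2 = X ^+ 2 + (Y - v) ^+ 2.
  by rewrite sqr_nrm !raddfB/= /X /Y /v; ring.
have wr : nrm (w - reflect_top c s z) ^+ 2 = X ^+ 2 + (Y + v) ^+ 2.
  by rewrite sqr_nrm !raddfB/= /X /Y /v; ring.
have cz : nrm (c - z) ^+ 2 = X0 ^+ 2 + (s - v) ^+ 2.
  by rewrite sqr_nrm !raddfB/= /X0 /v; ring.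
have cr : nrm (c - reflect_top c s z) ^+ 2 = X0 ^+ 2 + (s + v) ^+ 2.
  by rewrite sqr_nrm !raddfB/= /X0 /v; ring.
have X0s : `|X0| <= s / 10 by rewrite /X0 distrC.
have [X0l X0r] : - (s / 10) <= X0 /\ X0 <= s / 10.
  by move: X0s; rewrite ler_norml => /andP[].
have [Y0 Y2 XY] : [/\ 0 <= Y, Y <= 2 * s &
    [\/ Y = 0, Y = 2 * s | 9 / 10 * s <= `|X|]].
  move: wb X0l X0r; rewrite /X /Y /X0; case: (c) => c1 c2; case: (w) => w1 w2.
  rewrite /square_boundary /square /=.
  rewrite ?(mul0r, mul1r, addr0, add0r, subr0, sub0r, oppr0, mulr0).
  move=> [[/andP[? ?] /andP[? ?]] wb] ? ?; split; [lra|lra|].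
  case: wb => ?; [| |apply: Or32; lra|apply: Or31; lra]; apply: Or33.
    by rewrite ler0_norm; lra.
  by rewrite ger0_norm; lra.
(* With z' the reflected point, |w - z'|^2 - |w - z|^2 = 4 Y v. On the top edge Y = 0 and on the
   bottom edge Y = 2 s. On the sides |X| >= 9 s / 10, and 4 Y s <= (20 / 9) ((9 s / 10)^2 + Y^2),
   whence 223 / 100. *)
have key1 : (1 - 223 / 100 * (v / s)) * nrm (w - reflect_top c s z) ^+ 2 <=
    nrm (w - z) ^+ 2.
  rewrite wr wz; set t := v / s in vs t0 t1 Dt *.
  have h : 4 * Y * s <= 223 / 100 * (X ^+ 2 + (Y + v) ^+ 2).
    case: XY => [->|Y2s|Xs]; first by rewrite mulr0 mul0r mulr_ge0// addr_ge0 ?sqr_ge0.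
      have := sqr_ge0 X; rewrite Y2s; nra.
    have X2 : (9 / 10 * s) ^+ 2 <= X ^+ 2.
      rewrite -(real_normK (num_real X)) ler_pXn2r// nnegrE ?normr_ge0//; lra.
    have := sqr_ge0 (Y - 9 / 10 * s); nra.
  have := ler_wpM2l (ltW t0) h.
  have -> : t * (4 * Y * s) = 4 * Y * v by rewrite vs; ring.
  by move=> ?; rewrite mulrBl mul1r; lra.
(* At the centre the difference of squares is 4 s v, while |c - z'|^2 <= (1 + 121) s^2 / 100; and 4
   / 1.22 exceeds 32 / 10. *)
have key2 : nrm (c - z) ^+ 2 <=
    (1 - 32 / 10 * (v / s)) * nrm (c - reflect_top c s z) ^+ 2.
  rewrite cr cz; set t := v / s in vs t0 t1 Dt *.
  have h : 32 / 10 * (X0 ^+ 2 + (s + v) ^+ 2) <= 4 * s ^+ 2.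
    have : X0 ^+ 2 <= (s / 10) ^+ 2.
      by rewrite -(real_normK (num_real X0)) ler_pXn2r// nnegrE ?normr_ge0//; lra.
    nra.
  have := ler_wpM2l (ltW t0) h.
  have -> : t * (4 * s ^+ 2) = 4 * s * v by rewrite vs; ring.
  by move=> ?; rewrite mulrBl mul1r; lra.
have wz0 : 0 < nrm (w - z).
  rewrite nrm_gt0 subr_eq0; apply/eqP => wz'.
  have X00 : X = 0 by rewrite /X wz' subrr.
  have Yv : Y = v by rewrite /Y wz'.
  by case: XY; rewrite ?X00 ?normr0; lra.
have cz0 : 0 < nrm (c - z).
  rewrite nrm_gt0 subr_eq0; apply/eqP => cz'; move: us; rewrite /v cz'; lra.
rewrite !nrmM !nrmV mulrA ler_pdivrMr// mulrAC ler_pdivlMr//.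
rewrite -(@ler_pXn2r _ 2)// ?nnegrE ?mulr_ge0 ?nrm_ge0//; last exact: ltW.
rewrite !exprMn.
set A := nrm _ ^+ 2 in key1 *; set B := nrm _ ^+ 2 in key1 *.
have A0 : 0 <= A by rewrite sqr_ge0.
have C0 : 0 <= nrm (c - reflect_top c s z) ^+ 2 by rewrite sqr_ge0.
(* The gap between the two constants pays for q: with t = v / s, (1 - 9 t / 10) (1 - 223 t / 100) >=
   1 - 313 t / 100. *)
have q2 : 1 - 32 / 10 * (v / s) <= q ^+ 2 * (1 - 223 / 100 * (v / s)).
  have : 1 - 9 / 10 * (v / s) <= q ^+ 2.
    apply: (@le_trans _ _ ((1 - 9 / 20 * (v / s)) ^+ 2)); first by nra.
    by rewrite ler_pXn2r// ?nnegrE; rewrite /q; lra.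
  by move=> ?; nra.
set C := nrm (c - reflect_top c s z) ^+ 2 in key2 C0 *.
have h1 := ler_wpM2l A0 key2; have h2 := ler_wpM2r (mulr_ge0 A0 C0) q2.
have h3 := ler_wpM2l (mulr_ge0 (sqr_ge0 q) C0) key1.
set al := 1 - 32 / 10 * _ in h1 h2; set be := 1 - 223 / 100 * _ in h2 h3.
apply: (le_trans h1); apply: le_trans h3; rewrite [leLHS]mulrCA.
by rewrite [leRHS](_ : _ = q ^+ 2 * be * (A * C))//; ring.
Qed.

(** Multiplying g by the factors [rho j w ^+ d j] cancels its zeros. On the boundary each factor is
    at most q times its value at c, so [center_le_boundary] gives the claim after division by the
    values at c. *)
Lemma jensen_square (J : finType) (z : J -> R[i]) (d : J -> nat) g c s (M D : R) :
  0 < s -> 0 < D -> injective z ->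
  (forall w, square (square_corner c s) (2 * s) w -> differentiable g w) ->
  (forall j, D <= complex.Im c + s - complex.Im (z j) <= s / 10) ->
  (forall j, `|complex.Re (z j) - complex.Re c| <= s / 10) ->
  (forall j, exists K : R, exists2 e : R, 0 < e & forall w,
     nrm (w - z j) < e -> nrm (g w) <= K * nrm (w - z j) ^+ d j) ->
  (forall w, square_boundary (square_corner c s) (2 * s) w -> nrm (g w) <= M) ->
  nrm (g c) <= M * (1 - 9 / 20 * (D / s)) ^+ (\sum_j d j)%N.
Proof.
move=> s0 D0 zI gd zD zc gz gM; set q := 1 - _.
have cz j : c != z j.
  by apply/eqP => cz; have := zD j; rewrite -cz => /andP[_]; lra.
have cr j : c != reflect_top c s (z j).
  apply/eqP => cr; have /andP[Dj _] := zD j.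
  have : complex.Im c = 2 * (complex.Im c + s) - complex.Im (z j) by rewrite {1}cr.
  lra.
pose rho j w := (w - reflect_top c s (z j)) / (w - z j).
pose h w := g w * \prod_j rho j w ^+ d j.
have rho_q j w : square_boundary (square_corner c s) (2 * s) w ->
    nrm (rho j w) <= q * nrm (rho j c).
  exact: reflected_distance_ratio (zD j) (zc j).
have corner_bd : square_boundary (square_corner c s) (2 * s) (square_corner c s).
  by split; [split; apply/andP; split; lra|apply: Or41].
have M0 : 0 <= M by apply: le_trans (gM _ corner_bd); exact: nrm_ge0.
have P0 : 0 < \prod_j nrm (rho j c) ^+ d j.
  apply: prodr_gt0 => j _; rewrite exprn_gt0// nrm_gt0 mulf_neq0//.
    by rewrite subr_eq0.
  by rewrite invr_eq0 subr_eq0.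
have Pq : \prod_j (q * nrm (rho j c)) ^+ d j =
    q ^+ (\sum_j d j)%N * \prod_j nrm (rho j c) ^+ d j.
  rewrite -prodrXr -big_split.
  by apply: eq_bigr => j _; rewrite exprMn.
have nrm_h w : nrm (h w) = nrm (g w) * \prod_j nrm (rho j w) ^+ d j.
  by rewrite nrmM nrm_prod; congr (_ * _); apply: eq_bigr => j _; rewrite nrmX.
suff : nrm (h c) <= M * \prod_j (q * nrm (rho j c)) ^+ d j.
  by rewrite nrm_h Pq mulrA ler_pM2r.
have dfactor (n : nat) j w : w != z j -> differentiable (fun w => rho j w ^+ n : R[i]) w.
  move=> wz; case: n => [|n].
    have -> : (fun w => rho j w ^+ 0) = cst 1 by apply/funext.
    exact: differentiable_cst.
  have -> : (fun w => rho j w ^+ n.+1) = (rho j : R[i] -> R[i]) ^+ n.+1.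
    by apply/funext => x; rewrite exprfctE.
  apply: differentiableX.
  have -> : rho j = (fun w => w - reflect_top c s (z j)) * (fun w => (w - z j)^-1).
    by apply/funext.
  apply: differentiableM.
    by apply: differentiableB => //; exact: differentiable_cst.
  apply: differentiableV; last by rewrite subr_eq0.
  by apply: differentiableB => //; exact: differentiable_cst.
(* The z j are the exceptional points: the quotient [rho j] has the default value 0 there, and h
   only has to be bounded nearby. *)
apply: (@center_le_boundary _ h c s [seq z j | j : J]) => //.
- by apply/negP => /mapP[j _ /eqP]; rewrite (negbTE (cz j)).
- rewrite mulr_ge0// prodr_ge0// => j _; rewrite exprn_ge0//.
  exact: le_trans (nrm_ge0 _) (rho_q j _ corner_bd).
- move=> w wQ wE.
  have -> : h = g * (fun w => \prod_j rho j w ^+ d j) by apply/funext.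
  apply: differentiableM; first exact: gd.
  apply: differentiable_prodr => j _; apply: dfactor.
  by apply: contraNneq wE => ->; apply: map_f; rewrite mem_enum.
- move=> w wQ /mapP[j _ ->{w wQ}].
  have [K [e e0 gK]] := gz j.
  pose rest w := (w - reflect_top c s (z j)) ^+ d j * \prod_(i | i != j) rho i w ^+ d i.
  have drest : differentiable (rest : R[i] -> R[i]) (z j).
    have -> : rest = (fun w => \prod_(k < d j) (w - reflect_top c s (z j))) *
        (fun w => \prod_(i | i != j) rho i w ^+ d i).
      by apply/funext => w; rewrite /rest -[X in _ ^+ X]card_ord -prodr_const.
    apply: differentiableM.
      apply: differentiable_prodr => k _.
      by apply: differentiableB => //; exact: differentiable_cst.
    apply: differentiable_prodr => i ij; apply: dfactor.
    by apply: contraNneq ij => /zI ->.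
  have [L L0 [r r0 rL]] := differentiable_nrm_lipschitz drest.
  exists (`|K| * (nrm (rest (z j)) + L * r)), (Num.min e r).
    by rewrite lt_min e0.
  move=> w; rewrite lt_min => /andP[we wr].
  have hE : h w = g w * (w - z j)^-1 ^+ d j * rest w.
    rewrite /h (bigD1 j)//= /rest /rho exprMn; ring.
  rewrite hE nrmM; apply: ler_pM; rewrite ?nrm_ge0//.
    rewrite nrmM nrmX nrmV (le_trans (ler_wpM2r _ (gK _ we)))//.
      by rewrite exprn_ge0// invr_ge0 nrm_ge0.
    rewrite -mulrA -exprMn; have [->|wz] := eqVneq w (z j).
      rewrite subrr nrm0 mul0r expr0n; case: eqP => _; rewrite ?mulr1 ?mulr0//.
      exact: ler_norm.
    by rewrite divff ?expr1n ?mulr1 ?ler_norm// gt_eqF// nrm_gt0 subr_eq0.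
  rewrite -(subrK (rest (z j)) (rest w)) (le_trans (ler_nrmD _ _))// addrC lerD2l.
  by rewrite (le_trans (rL _ wr))// ler_pM2l// ltW.
- move=> w wb; rewrite nrm_h; apply: ler_pM; rewrite ?nrm_ge0 ?gM//.
    by apply: prodr_ge0 => j _; rewrite exprn_ge0// nrm_ge0.
  apply: ler_prod => j _; rewrite exprn_ge0 ?nrm_ge0//=.
  by rewrite lerXn2r ?nnegrE ?nrm_ge0 ?rho_q// (le_trans (nrm_ge0 _) (rho_q j _ wb)).
Qed.

End zeros.

(** * Positive semidefinite forms and Gram-Schmidt *)

Section psd_form.
Context {R : realType} {V : lmodType R[i]}.
Implicit Types (x y z : V) (a : R[i]) (e v : nat -> V).

(** Covers both the inner product and the possibly degenerate forms <A x, y> of positive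
    operators. *)
Record psd_form (w : V -> V -> R[i]) : Prop := PsdForm {
  psd_linear : forall a x y z, w (a *: x + y) z = a * w x z + w y z ;
  psd_sym : forall x y, w x y = Num.conj (w y x) ;
  psd_ge0 : forall x, 0 <= w x x }.

Context {w : V -> V -> R[i]} (wP : psd_form w).

Lemma psdDl x y z : w (x + y) z = w x z + w y z.
Proof. by rewrite -(scale1r x) psd_linear// mul1r scale1r. Qed.

Lemma psd0l z : w 0 z = 0.
Proof. by apply: (addIr (w 0 z)); rewrite -psdDl !add0r. Qed.

Lemma psdZl a x z : w (a *: x) z = a * w x z.
Proof. by rewrite -[a *: x]addr0 psd_linear// psd0l addr0. Qed.

Lemma psdNl x z : w (- x) z = - w x z.
Proof. by rewrite -scaleN1r psdZl mulN1r. Qed.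

Lemma psdBl x y z : w (x - y) z = w x z - w y z.
Proof. by rewrite psdDl psdNl. Qed.

Lemma psd_suml (I : Type) (r : seq I) (P : pred I) (F : I -> V) z :
  w (\sum_(i <- r | P i) F i) z = \sum_(i <- r | P i) w (F i) z.
Proof. exact: (big_morph (fun x => w x z) (fun x y => psdDl x y z) (psd0l z)). Qed.

Lemma psdDr x y z : w z (x + y) = w z x + w z y.
Proof. by rewrite psd_sym// psdDl rmorphD/= -!psd_sym. Qed.

Lemma psd0r z : w z 0 = 0.
Proof. by rewrite psd_sym// psd0l rmorph0. Qed.

Lemma psdZr a x z : w z (a *: x) = Num.conj a * w z x.
Proof. by rewrite psd_sym// psdZl rmorphM/= -psd_sym. Qed.

Lemma psdNr x z : w z (- x) = - w z x.
Proof. by rewrite psd_sym// psdNl rmorphN/= -psd_sym. Qed.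

Lemma psdBr x y z : w z (x - y) = w z x - w z y.
Proof. by rewrite psdDr psdNr. Qed.

Lemma psd_sumr (I : Type) (r : seq I) (P : pred I) (F : I -> V) z :
  w z (\sum_(i <- r | P i) F i) = \sum_(i <- r | P i) w z (F i).
Proof. exact: (big_morph (fun x => w z x) (fun x y => psdDr x y z) (psd0r z)). Qed.

Lemma psd_nrm_sym x y : nrm (w x y) = nrm (w y x).
Proof. by rewrite psd_sym// nrm_conj. Qed.

Lemma psd_real x : w x x = (complex.Re (w x x))%:C.
Proof. by rewrite RRe_real// ger0_real// psd_ge0. Qed.

Lemma psd_Re_ge0 x : 0 <= complex.Re (w x x).
Proof. by rewrite -lecR -psd_real psd_ge0. Qed.

Lemma mul_conj_nrm a : a * Num.conj a = (nrm a ^+ 2)%:C.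
Proof. by rewrite -normCK normr_nrm rmorphXn. Qed.

Lemma conj_real_complex (t : R) : Num.conj (t%:C : R[i]) = t%:C.
Proof. by apply: conj_Creal; apply/complex_realP; eexists. Qed.

Definition psd_orthonormal (w : V -> V -> R[i]) (m : nat) e :=
  forall i j, (i < m)%N -> (j < m)%N -> w (e i) (e j) = (i == j)%:R.

Definition psd_residue (w : V -> V -> R[i]) (m : nat) e x :=
  x - \sum_(k < m) w x (e k) *: e k.

Lemma psd_sum_orthonormal m e (a : nat -> R[i]) j : psd_orthonormal w m e ->
  (j < m)%N -> w (\sum_(k < m) a k *: e k) (e j) = a j.
Proof.
move=> eo jm; rewrite psd_suml (bigD1 (Ordinal jm))//= psdZl eo// eqxx mulr1.
rewrite big1 ?addr0// => k kj; rewrite psdZl eo//.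
by case: eqP => [kj'|]; [move: kj; rewrite -val_eqE/= kj' eqxx|rewrite mulr0].
Qed.

Lemma psd_residue_orthogonal m e x j : psd_orthonormal w m e ->
  (j < m)%N -> w (psd_residue w m e x) (e j) = 0.
Proof.
by move=> eo jm; rewrite psdBl (psd_sum_orthonormal (fun k => w x (e k)))// subrr.
Qed.

Lemma psd_residue_sqr m e x : psd_orthonormal w m e ->
  complex.Re (w (psd_residue w m e x) (psd_residue w m e x)) =
  complex.Re (w x x) - \sum_(k < m) nrm (w x (e k)) ^+ 2.
Proof.
move=> eo; rewrite {2}/psd_residue psdBr psd_sumr big1 => [|k _]; last first.
  by rewrite psdZr psd_residue_orthogonal// mulr0.
rewrite subr0 psdBl psd_suml raddfB/= raddf_sum/=; congr (_ - _).
by apply: eq_bigr => k _; rewrite psdZl [w (e k) x]psd_sym// mul_conj_nrm.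
Qed.

Lemma psd_bessel m e x : psd_orthonormal w m e ->
  \sum_(k < m) nrm (w x (e k)) ^+ 2 <= complex.Re (w x x).
Proof. by move=> eo; rewrite -subr_ge0 -psd_residue_sqr// psd_Re_ge0. Qed.

Lemma psd_sum_sqr m e (a : nat -> R[i]) : psd_orthonormal w m e ->
  let x := \sum_(k < m) a k *: e k in
  complex.Re (w x x) = \sum_(k < m) nrm (a k) ^+ 2.
Proof.
move=> eo /=; rewrite psd_sumr raddf_sum; apply: eq_bigr => k _.
by rewrite psdZr psd_sum_orthonormal// mulrC mul_conj_nrm.
Qed.

(** Positivity on s x - u y, where u is the phase of [w x y]. The free weight s serves to balance
    the two terms. *)
Lemma psd_amgm (s : R) x y : 0 < s ->
  nrm (w x y) <= (s * complex.Re (w x x) + s^-1 * complex.Re (w y y)) / 2.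
Proof.
move=> s0; have [->|nz] := eqVneq (w x y) 0.
  by rewrite nrm0 divr_ge0// addr_ge0// mulr_ge0 ?psd_Re_ge0 ?invr_ge0 ?ltW.
have n0 : 0 < nrm (w x y) by rewrite nrm_gt0.
pose u : R[i] := w x y / (nrm (w x y))%:C.
have uu : u * Num.conj u = 1.
  by rewrite mul_conj_nrm nrmM nrmV nrm_real gtr0_norm// divff ?expr1n// gt_eqF.
have uw : Num.conj u * w x y = (nrm (w x y))%:C.
  have -> : Num.conj u = Num.conj (w x y) / (nrm (w x y))%:C.
    by rewrite rmorphM fmorphV/= conj_real_complex.
  rewrite mulrAC [Num.conj _ * _]mulrC mul_conj_nrm -fmorphV -rmorphM/=.
  by rewrite expr2 mulfK// gt_eqF.
have := psd_Re_ge0 (s%:C *: x - u *: y).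
rewrite psdBl !psdBr !psdZl !psdZr.
rewrite conj_real_complex uw.
have -> : u * (s%:C * w y x) = s%:C * (nrm (w x y))%:C.
  rewrite mulrCA; congr (_ * _); rewrite -(conj_real_complex (nrm _)) -uw.
  by rewrite rmorphM/= conjCK -psd_sym.
rewrite [u * (_ * _)]mulrA uu mul1r psd_real [w y y]psd_real -!rmorphM/= => h.
have {}h : 0 <= s * (s * complex.Re (w x x)) - s * nrm (w x y) -
  (s * nrm (w x y) - complex.Re (w y y)) by [].
rewrite ler_pdivlMr// -(ler_pM2l s0).
have -> : s * (s * complex.Re (w x x) + s^-1 * complex.Re (w y y)) =
  s * (s * complex.Re (w x x)) + complex.Re (w y y) by field; rewrite gt_eqF.
lra.
Qed.

(** As the form may be degenerate, residues have length zero without being zero, and vectors whose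
    residue is null add nothing to the family. [C] records that the new vectors are combinations of
    the old ones. *)
Lemma psd_gram_schmidt n v : exists m e (C : nat -> nat -> R[i]),
  [/\ psd_orthonormal w m e,
      forall k, (k < m)%N -> e k = \sum_(i < n) C k i *: v i &
      forall i, (i < n)%N ->
        w (psd_residue w m e (v i)) (psd_residue w m e (v i)) = 0].
Proof.
elim: n => [|n [m [e [C [eo ev ve]]]]].
  by exists 0%N, (fun=> 0), (fun _ _ => 0); split.
set u := psd_residue w m e (v n).
have [u0|u0] := eqVneq (w u u) 0.
  exists m, e, (fun k i => if (i < n)%N then C k i else 0); split => //.
    move=> k km; rewrite big_ord_recr/= ltnn scale0r addr0 ev//.
    by apply: eq_bigr => i _; rewrite ltn_ord.
  by move=> i; rewrite ltnS leq_eqVlt => /predU1P[->//|/ve].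
pose a := Num.sqrt (complex.Re (w u u)).
have Re0 : 0 < complex.Re (w u u).
  by rewrite -ltcR -psd_real lt_neqAle eq_sym u0 psd_ge0.
have a0 : 0 < a by rewrite sqrtr_gt0.
have a2 : w u u = (a ^+ 2)%:C by rewrite sqr_sqrtr ?ltW// -psd_real.
pose e' k := if (k < m)%N then e k else a^-1%:C *: u.
have e'e (k : 'I_m) : e' k = e k by rewrite /e' ltn_ord.
have e'm : e' m = a^-1%:C *: u by rewrite /e' ltnn.
have e'o : psd_orthonormal w m.+1 e'.
  move=> i j; rewrite ltnS leq_eqVlt => im; rewrite ltnS leq_eqVlt.
  move: im => /predU1P[->|im] /predU1P[->|jm].
  - rewrite e'm psdZl psdZr a2 conj_real_complex -!rmorphM/= eqxx.
    by congr (_%:C); field; rewrite gt_eqF.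
  - rewrite e'm psdZl /e' jm psd_residue_orthogonal// mulr0.
    by rewrite gtn_eqF.
  - rewrite e'm psdZr psd_sym// /e' im psd_residue_orthogonal// rmorph0 mulr0.
    by rewrite ltn_eqF.
  - by rewrite /e' im jm; exact: eo.
exists m.+1, e', (fun k i => if (k < m)%N then (if (i < n)%N then C k i else 0)
  else a^-1%:C * (if (i < n)%N then - \sum_(l < m) w (v n) (e l) * C l i else 1)).
split => // [k|i im].
  rewrite ltnS leq_eqVlt => /predU1P[->|km]; rewrite big_ord_recr/= ltnn.
    rewrite e'm ltnn mulr1 /u /psd_residue scalerBr addrC; congr (_ + _).
    under [in RHS]eq_bigr do rewrite ltn_ord -scalerA.
    rewrite -scaler_sumr -scalerN -sumrN; congr (_ *: _).
    under [in RHS]eq_bigr do rewrite -sumrN scaler_suml.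
    rewrite exchange_big; apply: eq_bigr => l _ /=.
    rewrite ev// scaler_sumr -sumrN; apply: eq_bigr => i _.
    by rewrite scalerA scaleNr.
  rewrite km scale0r addr0 /e' km ev//.
  by apply: eq_bigr => i _; rewrite ltn_ord.
have key : w (v i) (e' m) = a^-1%:C * w (v i) u by rewrite e'm psdZr conj_real_complex.
suff : complex.Re (w (psd_residue w m.+1 e' (v i)) (psd_residue w m.+1 e' (v i))) <= 0.
  move=> h; rewrite psd_real (_ : complex.Re _ = 0)//.
  by apply/eqP; rewrite eq_le h psd_Re_ge0.
rewrite psd_residue_sqr// big_ord_recr/=.
under eq_bigr do rewrite e'e.
rewrite opprD addrA -psd_residue_sqr//.
move: im key; rewrite ltnS leq_eqVlt => /predU1P[->|/ve ->] key; last first.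
  by rewrite sub0r oppr_le0 sqr_ge0.
rewrite -/u key.
have -> : w (v n) u = w u u.
  rewrite /u {2}/psd_residue psdBl psd_suml big1 ?subr0// => k _.
  by rewrite psdZl [w (e k) _]psd_sym// psd_residue_orthogonal// rmorph0 mulr0.
rewrite a2 -rmorphM/= nrm_real real_normK ?num_real//.
by rewrite subr_le0 le_eqVlt; apply/orP; left; apply/eqP; field; rewrite gt_eqF.
Qed.

End psd_form.

(** * Hilbert spaces: projections and Parseval *)

Section completeness.
Context {R : realType}.

Lemma nrm_cauchy_cvg (V : completeNormedModType R[i]) (y : nat -> V) :
  (forall e : R, 0 < e -> exists N : nat, forall n m, (N <= n)%N -> (N <= m)%N ->
     nrm (y n - y m) < e) ->
  exists l, forall e : R, 0 < e -> exists N : nat, forall n, (N <= n)%N ->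
     nrm (y n - l) < e.
Proof.
move=> yc; have : cvg (y @ \oo).
  apply/cauchy_cvgP/cauchy_exP => e e0.
  have er : e = (complex.Re e)%:C by rewrite RRe_real// gtr0_real.
  have [|N NP] := yc (complex.Re e); first by rewrite -ltcR -er.
  exists (y N); exists N => // n /= Nn; rewrite -ball_normE /ball_ /=.
  by rewrite normr_nrm er ltcR NP.
move=> /cvg_ex[/= l yl]; exists l => e e0.
have /cvgrPdist_lt/(_ e%:C) := yl; rewrite ltcR => /(_ e0)[N _ NP].
by exists N => n /NP; rewrite distrC normr_nrm ltcR.
Qed.

End completeness.

Section hilbert.
Context {R : realType} {H : hilbertType R}.
Implicit Types (x y z : H).

Lemma hdot_psd : psd_form (hdot : H -> H -> R[i]).
Proof.
split => [a x y z|x y|x]; last by rewrite -hdotE exprn_ge0.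
  by rewrite linearDl linearZl_LR.
by rewrite hermC expr0 mul1r.
Qed.

Lemma sqr_nrm_hdot x : nrm x ^+ 2 = complex.Re (hdot x x).
Proof.
by apply: complexI; rewrite -(psd_real hdot_psd) -hdotE normr_nrm rmorphXn.
Qed.

Lemma hdot_eq0 x : hdot x x = 0 -> x = 0.
Proof.
move=> x0; apply: nrm0_eq0; apply/eqP; rewrite -sqrf_eq0 sqr_nrm_hdot x0.
by [].
Qed.

Lemma nrm_hdot_le x y : nrm (hdot x y) <= nrm x * nrm y.
Proof.
have [->|x0] := eqVneq x 0; first by rewrite (psd0l hdot_psd) !nrm0 mul0r.
have [->|y0] := eqVneq y 0; first by rewrite (psd0r hdot_psd) !nrm0 mulr0.
have nx : 0 < nrm x by rewrite nrm_gt0.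
have ny : 0 < nrm y by rewrite nrm_gt0.
apply: (le_trans (psd_amgm hdot_psd x y (divr_gt0 ny nx))).
rewrite -!sqr_nrm_hdot le_eqVlt; apply/orP; left; apply/eqP.
by field; rewrite !gt_eqF.
Qed.

Section basis.
Context {I : choiceType} {e : I -> H}.
Hypothesis eo : forall i j, hdot (e i) (e j) = (i == j)%:R.

Definition hproj (e : I -> H) (J : seq I) x := \sum_(i <- J) hdot x (e i) *: e i.

Lemma hdot_hproj J x j : uniq J ->
  hdot (hproj e J x) (e j) = if j \in J then hdot x (e j) else 0.
Proof.
move=> Ju; rewrite (psd_suml hdot_psd).
under eq_bigr do rewrite (psdZl hdot_psd) eo.
case: ifPn => jJ.
  rewrite (bigD1_seq j)//= eqxx mulr1 big1 ?addr0// => i /negbTE ->.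
  by rewrite mulr0.
by rewrite big_seq big1// => i iJ; case: eqP jJ => [<-|]; rewrite ?iJ// mulr0.
Qed.

Lemma hdot_hprojl J x : hdot (hproj e J x) x =
  (\sum_(i <- J) nrm (hdot x (e i)) ^+ 2)%:C.
Proof.
rewrite (psd_suml hdot_psd) rmorph_sum; apply: eq_bigr => i _.
by rewrite (psdZl hdot_psd) [hdot (e i) x](psd_sym hdot_psd) mul_conj_nrm.
Qed.

Lemma sqr_sub_hproj J x : uniq J -> nrm (x - hproj e J x) ^+ 2 =
  nrm x ^+ 2 - \sum_(i <- J) nrm (hdot x (e i)) ^+ 2.
Proof.
move=> Ju; rewrite !sqr_nrm_hdot (psdBr hdot_psd) [X in _ - X](psd_sumr hdot_psd).
rewrite [X in _ - X]big_seq [X in _ - X]big1 => [|i iJ]; last first.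
  by rewrite (psdZr hdot_psd) (psdBl hdot_psd) hdot_hproj// iJ subrr mulr0.
by rewrite subr0 (psdBl hdot_psd) hdot_hprojl raddfB.
Qed.

Lemma sum_hproj_le J x : uniq J ->
  \sum_(i <- J) nrm (hdot x (e i)) ^+ 2 <= nrm x ^+ 2.
Proof. by move=> Ju; rewrite -subr_ge0 -sqr_sub_hproj// sqr_ge0. Qed.

Lemma hproj_hproj J K x : uniq K -> {subset J <= K} ->
  hproj e J (hproj e K x) = hproj e J x.
Proof.
move=> Ku JK; rewrite /hproj big_seq [RHS]big_seq; apply: eq_bigr => i iJ.
by congr (_ *: _); rewrite hdot_hproj// JK.
Qed.

Lemma sqr_hproj J x : uniq J ->
  nrm (hproj e J x) ^+ 2 = \sum_(i <- J) nrm (hdot x (e i)) ^+ 2.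
Proof.
move=> Ju; have := sqr_sub_hproj (hproj e J x) Ju.
rewrite hproj_hproj// subrr nrm0 expr0n => /esym/eqP; rewrite subr_eq0 => /eqP ->.
by rewrite big_seq [RHS]big_seq; apply: eq_bigr => i iJ; rewrite hdot_hproj// iJ.
Qed.

Lemma sqr_hprojB J K x : uniq J -> uniq K -> {subset J <= K} ->
  nrm (hproj e K x - hproj e J x) ^+ 2 =
  \sum_(i <- K) nrm (hdot x (e i)) ^+ 2 - \sum_(i <- J) nrm (hdot x (e i)) ^+ 2.
Proof.
move=> Ju Ku JK; rewrite -(hproj_hproj x Ku JK) sqr_sub_hproj// sqr_hproj//.
congr (_ - _); rewrite big_seq [RHS]big_seq; apply: eq_bigr => i iJ.
by rewrite hdot_hproj// JK.
Qed.

End basis.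

(** The finite Bessel sums have a supremum, and the projections along sets [J n] approaching it are
    Cauchy. Their limit has the same coefficients as x, so it is x since the basis is complete. *)
Lemma parseval (I : choiceType) (e : I -> H) x (eps : R) : hilbert_basis e ->
  0 < eps -> exists2 J : seq I, uniq J &
    nrm x ^+ 2 <= \sum_(i <- J) nrm (hdot x (e i)) ^+ 2 + eps.
Proof.
move=> [eo ecomplete] eps0.
pose S J := \sum_(i <- J) nrm (hdot x (e i)) ^+ 2.
pose A := [set S J | J in [set J : seq I | uniq J]].
have Asup : has_sup A.
  split; first by exists (S [::]), [::].
  by exists (nrm x ^+ 2) => _ [J Ju <-]; exact: sum_hproj_le.
have Sle J : uniq J -> S J <= sup A.
  by move=> Ju; apply: sup_upper_bound => //; exists J.
have /choice[J JP] n : exists J : seq I, uniq J /\ sup A - n.+1%:R^-1 < S J.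
  have n0 : 0 < (n.+1%:R^-1 : R) by rewrite invr_gt0.
  by have [_ [J Ju <-] ?] := sup_adherent n0 Asup; exists J.
have Ju n := (JP n).1.
have near K n : uniq K -> {subset J n <= K} ->
    nrm (hproj e K x - hproj e (J n) x) ^+ 2 <= n.+1%:R^-1.
  move=> Ku JK; rewrite sqr_hprojB//; have := Sle _ Ku; have := (JP n).2.
  rewrite /S; move: (\sum_(i <- K) _) (\sum_(i <- J n) _) (n.+1%:R^-1) => a b d ? ?; lra.
have small (d : R) : 0 < d -> exists N : nat, forall n, (N <= n)%N ->
    (n.+1%:R^-1 : R) < d ^+ 2.
  move=> d0; exists (Num.Def.archi_bound (d ^+ 2)^-1) => n Nn.
  rewrite -[ltRHS]invrK ltf_pV2 ?posrE ?invr_gt0 ?exprn_gt0//.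
  apply: (lt_le_trans (archi_boundP _)); first by rewrite invr_ge0 sqr_ge0.
  by rewrite ler_nat ltnW.
have sqr_lt (a d : R) : 0 <= a -> 0 < d -> a ^+ 2 < d ^+ 2 -> a < d.
  by move=> a0 d0; rewrite ltr_pXn2r// nnegrE ltW.
have [y yP] : exists y, forall d : R, 0 < d -> exists N : nat,
    forall n, (N <= n)%N -> nrm (hproj e (J n) x - y) < d.
  apply: nrm_cauchy_cvg => d d0; have d20 : 0 < d / 2 by rewrite divr_gt0.
  have [N NP] := small _ d20; exists N => n m Nn Nm.
  pose K := undup (J n ++ J m); have Ku : uniq K by rewrite undup_uniq.
  have nK : {subset J n <= K} by move=> i; rewrite mem_undup mem_cat => ->.
  have mK : {subset J m <= K} by move=> i; rewrite mem_undup mem_cat orbC => ->.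
  have hn := sqr_lt _ _ (nrm_ge0 _) d20 (le_lt_trans (near _ _ Ku nK) (NP _ Nn)).
  have hm := sqr_lt _ _ (nrm_ge0 _) d20 (le_lt_trans (near _ _ Ku mK) (NP _ Nm)).
  have := ler_nrmB (hproj e K x - hproj e (J m) x) (hproj e K x - hproj e (J n) x).
  rewrite opprB [X in nrm X](_ : _ = hproj e (J n) x - hproj e (J m) x); first lra.
  by rewrite addrACA addrC addrA addrNK addrC.
have xy : x = y.
  apply/eqP; rewrite -subr_eq0; apply/eqP; apply: ecomplete => i.
  apply: nrm0_eq0; apply/eqP; rewrite eq_le nrm_ge0 andbT.
  apply/ler_addgt0Pl => d d0; rewrite addr0; have d20 : 0 < d / 2 by rewrite divr_gt0.
  have [N NP] := small _ d20; have [N' N'P] := yP _ d20.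
  pose n := maxn N N'; have h := N'P n (leq_maxr _ _).
  have ei : nrm (e i) = 1.
    by apply/eqP; rewrite -(@eqrXn2 _ 2) ?nrm_ge0// sqr_nrm_hdot eo eqxx expr1n.
  rewrite -(subrKA (hproj e (J n) x)) (psdDl hdot_psd) (le_trans (ler_nrmD _ _))//.
  rewrite [leRHS](splitr d) lerD//; last first.
    by rewrite (le_trans (nrm_hdot_le _ _))// ei mulr1 ltW.
  apply: ltW; apply: sqr_lt => //; first exact: nrm_ge0.
  apply: le_lt_trans (NP n (leq_maxl _ _)).
  rewrite (psdBl hdot_psd) hdot_hproj//; case: ifPn => iJ.
    by rewrite subrr nrm0 expr0n invr_ge0.
  (* For i outside [J n] the coefficient is small: adding i to [J n] cannot push the sum above the
     supremum. *)
  have Ku : uniq (i :: J n) by rewrite /= iJ Ju.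
  have := Sle _ Ku; have := (JP n).2; rewrite /S big_cons subr0.
  by move: (n.+1%:R^-1) => ? ? ?; lra.
have [x0|x0] := eqVneq x 0.
  by exists [::] => //; rewrite x0 nrm0 expr0n big_nil add0r ltW.
have nx : 0 < nrm x by rewrite nrm_gt0.
have [N NP] := yP (eps / (2 * nrm x)) (divr_gt0 eps0 (mulr_gt0 (ltr0n _ 2) nx)).
exists (J N) => //; rewrite -sqr_hproj//.
have := NP N (leqnn _); rewrite -xy nrmBC ltr_pdivlMr ?mulr_gt0// => h.
have := ler_nrmD (x - hproj e (J N) x) (hproj e (J N) x); rewrite subrK => h1.
have h2 : nrm (hproj e (J N) x) <= nrm x.
  by rewrite -(@ler_pXn2r _ 2)// ?nnegrE ?nrm_ge0// sqr_hproj// sum_hproj_le.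
have := nrm_ge0 (hproj e (J N) x); have := nrm_ge0 (x - hproj e (J N) x).
nra.
Qed.

Lemma opnorm_le (f : H -> H) (M : R) x :
  (forall (a : R[i]) y, f (a *: y) = a *: f y) ->
  (opnorm f <= M%:E)%E -> nrm (f x) <= M * nrm x.
Proof.
move=> fZ fM; have le1 y : `|y| <= 1 -> nrm (f y) <= M.
  move=> y1; rewrite -lee_fin (le_trans _ fM)//.
  by apply: ereal_sup_ubound; exists y.
have [->|x0] := eqVneq x 0.
  by rewrite -(scale0r 0) fZ !scale0r !nrm0 mulr0.
have nx : 0 < nrm x by rewrite nrm_gt0.
have := le1 ((nrm x)^-1%:C *: x); rewrite fZ nrmZ nrm_real ger0_norm ?invr_ge0 ?nrm_ge0//.
rewrite mulrC ler_pdivrMr//; apply.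
rewrite normr_nrm nrmZ nrm_real ger0_norm ?invr_ge0 ?nrm_ge0//.
by rewrite mulVf ?gt_eqF.
Qed.

Lemma bounded_op_nrm (A : {linear H -> H}) : bounded_op A ->
  exists2 M : R, 0 <= M & forall x, nrm (A x) <= M * nrm x.
Proof.
move=> Ab; have A0 : (0 <= opnorm A)%E.
  by apply: ereal_sup_ubound; exists 0; rewrite /= ?normr0// linear0 normr0.
have AE : opnorm A = (fine (opnorm A))%:E by rewrite fineK// ge0_fin_numE.
exists (fine (opnorm A)); first exact: fine_ge0.
by move=> x; apply: opnorm_le; [move=> a y; rewrite linearZ|rewrite -AE].
Qed.

End hilbert.

(** * Estimates with the trace norm *)

Section trace.
Context {R : realType} {H : hilbertType R}.
Implicit Types (x y z : H) (A K S : {linear H -> H}).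

(** Over the complex numbers positivity forces Hermitian symmetry: polarise with x + y and x + 'i *:
    y. *)
Lemma positive_psd A : (forall x, 0 <= hdot (A x) x) ->
  psd_form (fun x y => hdot (A x) y).
Proof.
move=> A0; have hP := @hdot_psd R H; split => [a x y z|x y|//].
  by rewrite linearP (psd_linear hP).
have re x' : complex.Im (hdot (A x') x') = 0 by rewrite ger0_Im.
have := re (x + 'i *: y); have := re (x + y).
rewrite [A (x + y)]linearD [A (x + 'i *: y)]linearD [A ('i *: y)]linearZ.
rewrite !(psdDl hP) !(psdDr hP) !(psdZl hP) !(psdZr hP).
rewrite -[Num.conj 'i]/(('i : R[i])^*)%C.
have := re x; have := re y.
case: (hdot (A x) x) => x1 x2; case: (hdot (A y) y) => y1 y2.
rewrite -[Num.conj _]/((hdot (A y) x)^*)%C.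
case: (hdot (A x) y) => a b; case: (hdot (A y) x) => c d /=.
by move=> -> -> h1 h2; congr (_ +i* _); lra.
Qed.

(* Orthonormalising g for the form <A x, y> avoids the square root of A.       *)
Lemma trace_bessel (I : choiceType) (b : I -> H) A (t B : R) n (g : nat -> H) :
  (forall x, 0 <= hdot (A x) x) -> hilbert_basis b ->
  (forall J : seq I, uniq J -> \sum_(i <- J) complex.Re (hdot (A (b i)) (b i)) <= t) ->
  0 <= B -> (forall y, \sum_(k < n) nrm (hdot y (g k)) ^+ 2 <= B * nrm y ^+ 2) ->
  \sum_(k < n) complex.Re (hdot (A (g k)) (g k)) <= B * t.
Proof.
move=> A0 bP bt B0 gB; have wP := positive_psd A0.
have [m [h [C [ho _ gh]]]] := psd_gram_schmidt wP n g.
(* The residues of the [g k] are null, so Bessel's inequality is an equality for them. *)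
have E (k : 'I_n) : complex.Re (hdot (A (g k)) (g k)) =
    \sum_(q < m) nrm (hdot (A (h q)) (g k)) ^+ 2.
  have := psd_residue_sqr wP (g k) ho; rewrite gh// => /esym/eqP.
  rewrite subr_eq0 => /eqP ->; apply: eq_bigr => q _.
  by rewrite (psd_nrm_sym wP).
rewrite (eq_bigr _ (fun k _ => E k)) exchange_big/=.
apply: (@le_trans _ _ (\sum_(q < m) B * nrm (A (h q)) ^+ 2)).
  by apply: ler_sum => q _; exact: gB.
rewrite -mulr_sumr ler_wpM2l//; apply/ler_addgt0Pr => eps eps0.
(* Parseval expands |A (h q)|^2 along b up to eps. For each [b i], Bessel's inequality for the form
   bounds the sum over q by <A (b i), b i>, and these add up to at most t. *)
have d0 : 0 < eps / m.+1%:R by rewrite divr_gt0.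
have /choice[J JP] (q : 'I_m) : exists J : seq I, uniq J /\ nrm (A (h q)) ^+ 2 <=
    \sum_(i <- J) nrm (hdot (A (h q)) (b i)) ^+ 2 + eps / m.+1%:R.
  by have [J] := parseval (A (h q)) bP d0; exists J.
pose K := undup (flatten [seq J q | q : 'I_m]).
have Ku : uniq K by exact: undup_uniq.
apply: (@le_trans _ _ (\sum_(q < m) (\sum_(i <- K) nrm (hdot (A (h q)) (b i)) ^+ 2
    + eps / m.+1%:R))).
  apply: ler_sum => q _; have [Ju] := JP q; move=> /le_trans; apply.
  rewrite lerD2r -subr_ge0 -(sqr_hprojB bP.1 _ Ju Ku) ?sqr_ge0// => i iJ.
  by rewrite mem_undup; apply/flattenP; exists (J q) => //; apply: map_f; rewrite mem_enum.
rewrite big_split/=; apply: lerD.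
  rewrite exchange_big/=; apply: le_trans (bt _ Ku); apply: ler_sum => i _.
  apply: le_trans (psd_bessel wP (b i) ho); apply: ler_sum => q _.
  by rewrite (psd_nrm_sym wP).
rewrite sumr_const card_ord -(mulr_natl (eps / _)) mulrCA.
apply: ler_piMr; first exact: ltW.
by rewrite ler_pdivrMr// mul1r ler_nat.
Qed.

Lemma trace_norm_witness (T : H -> H) (t t' : R) : (trace_norm T <= t%:E)%E -> t < t' ->
  exists A (I : choiceType) (e : I -> H), [/\ absolute_value T A, hilbert_basis e &
    forall J : seq I, uniq J ->
      \sum_(i <- J) complex.Re (hdot (A (e i)) (e i)) <= t'].
Proof.
move=> Tt tt'; have : (trace_norm T < t'%:E)%E by rewrite (le_lt_trans Tt)// lte_fin.
move=> /ereal_inf_lt[_ [A [I [e [TA eb ->]]]]] et.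
exists A, I, e; split => // J Ju.
rewrite -lee_fin (le_trans _ (ltW et))//.
rewrite -sumEFin; apply: ereal_sup_ubound; exists [set` J]; first by split.
by rewrite -fsbig_seq.
Qed.

(** With A = |K|, each term is <A u_k, g_k>, where g_k absorbs S and the polar isometry of K. Then
    [psd_amgm] separates u from g, and [trace_bessel] bounds both sums. *)
Lemma trace_norm_pairing K S (t M : R) n (u f : nat -> H) :
  (trace_norm K <= t%:E)%E -> 0 < M -> (forall x, nrm (S x) <= M * nrm x) ->
  psd_orthonormal hdot n u -> psd_orthonormal hdot n f ->
  \sum_(k < n) nrm (hdot (S (K (u k))) (f k)) <= M * t.
Proof.
move=> Kt M0 SM uo fo; have hP := @hdot_psd R H.
suff H1 t' : t < t' -> \sum_(k < n) nrm (hdot (S (K (u k))) (f k)) <= M * t'.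
  apply/ler_addgt0Pr => eps eps0.
  apply: (le_trans (H1 (t + eps / M) _)); first by rewrite ltrDl divr_gt0.
  by rewrite mulrDr mulrCA divff ?mulr1// gt_eqF.
move=> /(trace_norm_witness Kt)[A [I [b [[_ A0 KA] bb bt]]]].
have wP := positive_psd A0.
have [m [p [C [po pA Ap]]]] := psd_gram_schmidt hP n (fun l => A (u l)).
pose x q := \sum_(l < n) C q l *: u l; pose y q := K (x q).
have Ax q : (q < m)%N -> A (x q) = p q.
  by move=> qm; rewrite pA// linear_sum; apply: eq_bigr => l _; rewrite linearZ.
(* Since K* K = A^2, K takes the [x q] to an orthonormal family, as A does. *)
have yo : psd_orthonormal hdot m y.
  by move=> i j im jm; rewrite -KA !Ax//; exact: po.
have Ku (l : 'I_n) : K (u l) = \sum_(q < m) hdot (A (u l)) (p q) *: y q.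
  apply/eqP; rewrite -subr_eq0; apply/eqP; apply: hdot_eq0.
  have -> : K (u l) - \sum_(q < m) hdot (A (u l)) (p q) *: y q =
      K (u l - \sum_(q < m) hdot (A (u l)) (p q) *: x q).
    rewrite [RHS]linearB [in RHS]linear_sum; congr (_ - _).
    by apply: eq_bigr => q _; rewrite linearZ.
  have AE : A (u l - \sum_(q < m) hdot (A (u l)) (p q) *: x q) =
      psd_residue hdot m p (A (u l)).
    rewrite /psd_residue [LHS]linearB [in LHS]linear_sum; congr (_ - _).
    by apply: eq_bigr => q _; rewrite linearZ Ax.
  by rewrite -KA AE Ap.
(* The partial isometry of the polar decomposition of K maps p q to y q, so    *)
(* that g k represents the functional <S (K _), f k> on the span of the A u l. *)
pose c k q := hdot (S (y q)) (f k).
pose g k := \sum_(q < m) Num.conj (c k q) *: p q.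
have hg z k : hdot z (g k) = \sum_(q < m) hdot z (p q) * c k q.
  rewrite (psd_sumr hP); apply: eq_bigr => q _.
  by rewrite (psdZr hP) conjCK mulrC.
have Sg (k : 'I_n) : hdot (S (K (u k))) (f k) = hdot (A (u k)) (g k).
  rewrite Ku hg linear_sum (psd_suml hP); apply: eq_bigr => q _.
  by rewrite linearZ (psdZl hP).
have gM z : \sum_(k < n) nrm (hdot z (g k)) ^+ 2 <= M ^+ 2 * nrm z ^+ 2.
  pose z' := \sum_(q < m) hdot z (p q) *: y q.
  have zz' k : hdot z (g k) = hdot (S z') (f k).
    rewrite hg linear_sum (psd_suml hP); apply: eq_bigr => q _.
    by rewrite linearZ (psdZl hP).
  under eq_bigr do rewrite zz'.
  apply: (le_trans (psd_bessel hP (S z') fo)); rewrite -sqr_nrm_hdot.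
  apply: (@le_trans _ _ ((M * nrm z') ^+ 2)).
    by rewrite ler_pXn2r// ?nnegrE ?nrm_ge0// (le_trans (nrm_ge0 _) (SM _)).
  rewrite exprMn ler_wpM2l ?sqr_ge0// [leLHS]sqr_nrm_hdot.
  rewrite (psd_sum_sqr hP (fun q => hdot z (p q)) yo) sqr_nrm_hdot.
  exact: psd_bessel.
have T1 : \sum_(k < n) complex.Re (hdot (A (u k)) (u k)) <= 1 * t'.
  apply: (trace_bessel A0 bb bt ler01) => z.
  by rewrite mul1r sqr_nrm_hdot; exact: psd_bessel.
have T2 := trace_bessel A0 bb bt (sqr_ge0 M) gM.
(* The weight M balances the Bessel constants, 1 for u and M^2 for g. *)
apply: (@le_trans _ _ (\sum_(k < n) (M * complex.Re (hdot (A (u k)) (u k)) +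
    M^-1 * complex.Re (hdot (A (g k)) (g k))) / 2)).
  by apply: ler_sum => k _; rewrite Sg; exact: (psd_amgm wP).
rewrite -mulr_suml big_split/= -!mulr_sumr ler_pdivrMr//.
have := ler_wpM2l (ltW M0) T1.
have := ler_wpM2l (_ : 0 <= M^-1) T2; rewrite invr_ge0 ltW// => /(_ isT).
have -> : M^-1 * (M ^+ 2 * t') = M * t' by field; rewrite gt_eqF.
rewrite mul1r; lra.
Qed.

End trace.

(** * Size and vanishing order of determinants *)

Section det_bound.
Context {R : realType}.

Lemma unitary_orthonormal (H : hilbertType R) m (P : 'M[R[i]]_m.+1) (e : nat -> H) :
  P \is unitarymx -> psd_orthonormal hdot m.+1 e ->
  psd_orthonormal hdot m.+1
    (fun k => \sum_(i < m.+1) P (inord k) (inord i) *: e i).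
Proof.
move=> /unitarymxP PP eo k j km jm; have hP := @hdot_psd R H.
rewrite (psd_suml hP).
have := congr1 (fun M : 'M[R[i]]_m.+1 => M (inord k) (inord j)) PP.
rewrite !mxE -val_eqE/= !inordK// => <-; apply: eq_bigr => i _.
rewrite (psdZl hP) [hdot (e i) _](psd_sym hP).
rewrite (psd_sum_orthonormal hP (fun i => P (inord j) (inord i)) eo)//.
by rewrite inord_val !mxE.
Qed.

Lemma orthonormal_nrm (H : hilbertType R) m (e : nat -> H) k :
  psd_orthonormal hdot m e -> (k < m)%N -> nrm (e k) = 1.
Proof.
move=> eo km; apply/eqP; rewrite -(@eqrXn2 _ 2) ?nrm_ge0// sqr_nrm_hdot eo//.
by rewrite eqxx expr1n.
Qed.

(** Rotating both families by the unitary matrix of a Schur triangularisation makes the determinant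
    a product of diagonal entries, of modulus at most 1 + |<S K e'_k, f'_k>|. Bounding each by an
    exponential leaves the sum of [trace_norm_pairing], so the dimension m does not enter. *)
Lemma det_perturbation_le (H : hilbertType R) (K S : {linear H -> H}) (t M : R)
    m (e f : nat -> H) :
  (trace_norm K <= t%:E)%E -> 0 < M -> (forall x, nrm (S x) <= M * nrm x) ->
  psd_orthonormal hdot m e -> psd_orthonormal hdot m f ->
  nrm (\det (\matrix_(i < m, l < m) hdot (e i + S (K (e i))) (f l))) <= expR (M * t).
Proof.
move=> Kt M0 SM eo fo; have hP := @hdot_psd R H.
(* For m = 0 the determinant is 1, and the empty pairing gives 0 <= M t. *)
case: m eo fo => [_ _|m eo fo].
  rewrite det_mx00 nrm1 -expR0 ler_expR.
  have := @trace_norm_pairing _ _ K S t M 0 (fun=> 0) (fun=> 0) Kt M0 SM.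
  by rewrite big_ord0; apply.
set X := \matrix_(i, l) _.
have [//|P Pu PX] := Schur X.
have {}PX : is_trig_mx (P *m X *m map_mx Num.conj P^T) by rewrite -conjymx.
have -> : \det X = \det (P *m X *m map_mx Num.conj P^T).
  rewrite !det_mulmx mulrAC -det_mulmx.
  by have /unitarymxP -> := Pu; rewrite det1 mul1r.
rewrite det_trig// nrm_prod.
pose e' k := \sum_(i < m.+1) P (inord k) (inord i) *: e i.
pose f' k := \sum_(i < m.+1) P (inord k) (inord i) *: f i.
have e'o : psd_orthonormal hdot m.+1 e' by exact: unitary_orthonormal.
have f'o : psd_orthonormal hdot m.+1 f' by exact: unitary_orthonormal.
have XE (k : 'I_m.+1) : (P *m X *m map_mx Num.conj P^T) k k = hdot (e' k + S (K (e' k))) (f' k).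
  have -> : e' k + S (K (e' k)) = \sum_(i < m.+1) P k i *: (e i + S (K (e i))).
    rewrite /e' !linear_sum -big_split; apply: eq_bigr => i _ /=.
    by rewrite !inord_val !linearZ -scalerDr.
  rewrite (psd_sumr hP) !mxE; apply: eq_bigr => l _.
  rewrite (psdZr hP) !inord_val (psd_suml hP) !mxE mulrC; congr (_ * _).
  by apply: eq_bigr => i _; rewrite (psdZl hP) !mxE.
apply: (@le_trans _ _ (\prod_(k < m.+1) expR (nrm (hdot (S (K (e' k))) (f' k))))).
  apply: ler_prod => k _; rewrite nrm_ge0 XE/= (psdDl hP).
  apply: le_trans (expR_ge1Dx _); apply: (le_trans (ler_nrmD _ _)).
  rewrite lerD2r (le_trans (nrm_hdot_le _ _))//.
  by rewrite (orthonormal_nrm e'o)// (orthonormal_nrm f'o)// mulr1.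
rewrite -(big_morph _ (@expRD R) (@expR0 R)) ler_expR.
exact: trace_norm_pairing Kt M0 SM e'o f'o.
Qed.

Lemma nrm_det_le n (A : 'M[R[i]]_n) (B : 'I_n -> R) :
  (forall i j, nrm (A i j) <= B i) ->
  nrm (\det A) <= #|{perm 'I_n}|%:R * \prod_i B i.
Proof.
move=> AB; apply: (le_trans (ler_nrm_sum _ _ _)).
rewrite mulr_natl -sumr_const; apply: ler_sum => s _.
rewrite nrmM nrmX nrmN nrm1 expr1n mul1r nrm_prod.
by apply: ler_prod => i _; rewrite nrm_ge0 AB.
Qed.

(** An invertible change of rows makes the first d rows vanish at z. Near z these are O(|w - z|),
    and the Leibniz expansion takes one entry from each. *)
Lemma det_vanishing m d (A : R[i] -> 'M[R[i]]_m) z (V : 'M[R[i]]_(d, m)) :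
  row_free V -> V *m A z = 0 ->
  (forall i j, differentiable ((fun w => A w i j) : R[i] -> R[i]) z) ->
  exists K : R, exists2 r : R, 0 < r &
    forall w, nrm (w - z) < r -> nrm (\det (A w)) <= K * nrm (w - z) ^+ d.
Proof.
move=> Vfree VA dA.
have dm : (d <= m)%N by rewrite -(eqP Vfree) rank_leq_col.
pose Q := row_ebase V; have Qu : Q \in unitmx by exact: row_ebase_unit.
pose B w := Q *m A w.
have B0 (i : 'I_m) j : (i < d)%N -> B z i j = 0.
  move=> id; have : (pid_mx d : 'M[R[i]]_(d, m)) *m B z = 0.
    have := mulmx_ebase V; rewrite (eqP Vfree) => VE.
    apply: (row_full_inj (A := col_ebase V)).
      by rewrite row_full_unit col_ebase_unit.
    by rewrite mulmx0 -VA -{2}VE !mulmxA.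
  move=> /matrixP/(_ (Ordinal id) j); rewrite mxE (bigD1 i)//= big1 => [|k ki].
    by rewrite !mxE /= eqxx id mul1r addr0.
  by rewrite !mxE /= eq_sym -[_ == _]/(k == i) (negbTE ki) mul0r.
have BE w i j : B w i j = \sum_k Q i k * A w k j by rewrite mxE.
have dB i j : differentiable ((fun w => B w i j) : R[i] -> R[i]) z.
  have -> : (fun w => B w i j) = (fun w => \sum_k (cst (Q i k) * (fun w => A w k j)) w : R[i]).
    by apply/funext => w; rewrite BE.
  apply: differentiable_sumr => k _; apply: differentiableM => //.
have /choice[L LP] (ij : 'I_m * 'I_m) : exists L : R, 0 < L /\ \forall w \near z,
    nrm (B w ij.1 ij.2 - B z ij.1 ij.2) <= L * nrm (w - z).
  have [L L0 [r r0 rL]] := differentiable_nrm_lipschitz (dB ij.1 ij.2).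
  by exists L; split => //; apply/nbhs_nrmP; exists r.
have /nbhs_nrmP[r r0 rP] : \forall w \near z, forall ij : 'I_m * 'I_m,
    nrm (B w ij.1 ij.2 - B z ij.1 ij.2) <= L ij * nrm (w - z).
  apply: (@filter_forall _ _ (fun ij : 'I_m * 'I_m => [set w | nrm (B w ij.1 ij.2 -
    B z ij.1 ij.2) <= L ij * nrm (w - z)]) (nbhs z)) => ij; exact: (LP ij).2.
pose T := \sum_ij (L ij + nrm (B z ij.1 ij.2)).
have T0 ij : L ij + nrm (B z ij.1 ij.2) <= T.
  rewrite /T (bigD1 ij)//= lerDl sumr_ge0// => k _.
  by rewrite addr_ge0 ?nrm_ge0// ltW// (LP k).1.
exists (nrm (\det Q)^-1 * (#|{perm 'I_m}|%:R * T ^+ m)), (Num.min r 1).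
  by rewrite lt_min r0 ltr01.
move=> w; rewrite lt_min => /andP[wr w1].
have -> : \det (A w) = (\det Q)^-1 * \det (B w).
  by rewrite det_mulmx mulKf// -unitfE -unitmxE.
rewrite nrmM -mulrA ler_wpM2l ?nrm_ge0//.
have hB i j : nrm (B w i j) <= T * (if (i < d)%N then nrm (w - z) else 1).
  have Lw := rP w wr (i, j); have L0 := (LP (i, j)).1.
  have := T0 (i, j); have := nrm_ge0 (B z i j); have := nrm_ge0 (w - z).
  move: Lw => /=; case: ifPn => id; first by rewrite B0// subr0 nrm0; nra.
  move=> Lw; have := ler_nrmD (B w i j - B z i j) (B z i j); rewrite subrK.
  by move=> h ? ? ?; rewrite mulr1; nra.
apply: (le_trans (nrm_det_le hB)); rewrite -mulrA ler_wpM2l//.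
rewrite big_split/= prodr_const card_ord -big_mkcond/= prodr_const.
suff -> : #|[pred i : 'I_m | (i < d)%N]| = d by [].
rewrite -sum1_card (eq_bigl (fun i : 'I_m => (i < d)%N))//.
by rewrite (big_ord_narrow dm) sum1_card card_ord.
Qed.

End det_bound.

(** * Neumann series *)

Section resolvent.
Context {R : realType} {H : hilbertType R}.
Implicit Types (x y : H) (T V : {linear H -> H}).

Lemma expr_lt_near0 (q e : R) : 0 <= q < 1 -> 0 < e ->
  exists N : nat, forall n, (N <= n)%N -> q ^+ n < e.
Proof.
move=> /andP[q0 q1] e0.
have qn : `|q| < 1 by rewrite ger0_norm.
have /cvgrPdist_lt := cvg_expr qn; move=> /(_ e e0)[N _ NP].
exists N => n /NP; rewrite /= sub0r normrN ger0_norm ?exprn_ge0//.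
Qed.

Lemma neumann V (q : R) y : 0 <= q < 1 -> (forall x, nrm (V x) <= q * nrm x) ->
  exists2 x, x - V x = y & nrm x <= (1 - q)^-1 * nrm y.
Proof.
move=> /andP[q0 q1] Vq; have q1' : 0 < 1 - q by rewrite subr_gt0.
pose x := fix x n := if n is k.+1 then y + V (x k) else 0.
have xb n : nrm (x n) <= (1 - q)^-1 * nrm y.
  elim: n => [|n IH]; first by rewrite nrm0 mulr_ge0 ?nrm_ge0// invr_ge0 ltW.
  rewrite /= (le_trans (ler_nrmD _ _))//.
  apply: (@le_trans _ _ (nrm y + q * ((1 - q)^-1 * nrm y))).
    by rewrite lerD2l (le_trans (Vq _))// ler_wpM2l.
  by rewrite le_eqVlt; apply/orP; left; apply/eqP; field; rewrite gt_eqF.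
have xd n k : nrm (x (n + k)%N - x n) <= q ^+ n * ((1 - q)^-1 * nrm y).
  elim: n => [|n IH]; first by rewrite add0n subr0 mul1r.
  rewrite addSn /= opprD addrACA subrr add0r -linearB (le_trans (Vq _))//.
  by rewrite exprS -mulrA ler_wpM2l.
set C := (1 - q)^-1 * nrm y in xb xd *.
have C0 : 0 <= C by rewrite mulr_ge0 ?nrm_ge0// invr_ge0 ltW.
have [l lP] : exists l, forall e : R, 0 < e -> exists N : nat,
    forall n, (N <= n)%N -> nrm (x n - l) < e.
  apply: nrm_cauchy_cvg => e e0.
  have q01 : 0 <= q < 1 by rewrite q0.
  have eC : 0 < e / (2 * (C + 1)) by rewrite divr_gt0// mulr_gt0// ltr_wpDl.
  have [N NP] := expr_lt_near0 q01 eC.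
  exists N; suff h n : (N <= n)%N -> nrm (x n - x N) < e / 2.
    move=> n m /h hn /h hm.
    have -> : x n - x m = (x n - x N) - (x m - x N) by rewrite opprB addrA subrK.
    by apply: (le_lt_trans (ler_nrmB _ _)); lra.
  move=> Nn; have := xd N (n - N)%N; rewrite subnKC// => /le_lt_trans; apply.
  have := NP N (leqnn _); rewrite ltr_pdivlMr; last by rewrite mulr_gt0// ltr_wpDl.
  have := exprn_ge0 N q0; nra.
exists l.
  apply/eqP; rewrite -subr_eq0; apply/eqP; apply: nrm0_eq0; apply/eqP.
  rewrite eq_le nrm_ge0 andbT; apply/ler_addgt0Pl => e e0; rewrite addr0.
  have [N NP] := lP (e / 2) (divr_gt0 e0 (ltr0n _ 2)).
  have h1 := NP N (leqnn _); have := NP N.+1 (leqnSn _) => /= h2.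
  have -> : l - V l - y = V (x N - l) - (y + V (x N) - l).
    rewrite linearB opprB opprD !addrA.
    by rewrite [RHS](ACl (1 * 5 * (3 * 2 * 4)))/= subrr add0r.
  have := Vq (x N - l); have := nrm_ge0 (x N - l).
  have := ler_nrmB (V (x N - l)) (y + V (x N) - l); nra.
apply/ler_addgt0Pl => e e0; have [N NP] := lP e e0.
have := NP N (leqnn _); rewrite nrmBC => h.
have := ler_nrmD (l - x N) (x N); rewrite subrK; have := xb N; lra.
Qed.

(** With V = T^-1 of norm at most q, the inverse of Id - T is - V (Id - V)^-1. For q = 1 / (1 + c
    |Im z|) the bound q / (1 - q) is 1 / (c |Im z|). *)
Lemma resolvent T (q : R) : 0 <= q < 1 -> inverse_norm_le T q ->
  exists W : {linear H -> H}, [/\ forall y, W y - T (W y) = y,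
    forall x, W (x - T x) = x & forall y, nrm (W y) <= q / (1 - q) * nrm y].
Proof.
move=> q01 [V [[_ TV VT] Vq]]; have [q0 q1] := andP q01.
have {}Vq x : nrm (V x) <= q * nrm x.
  by apply: opnorm_le => // a y; rewrite linearZ.
have /choice[w wP] y : exists x, x - T x = y /\ nrm x <= q / (1 - q) * nrm y.
  have [x xE xb] := neumann (- y) q01 Vq; exists (V x).
  by rewrite VT -opprB xE opprK (le_trans (Vq _))// -mulrA ler_wpM2l// -(nrmN y).
have inj x : x - T x = 0 -> x = 0.
  move=> /eqP; rewrite subr_eq0 => /eqP xT; have := Vq x.
  rewrite {1}xT TV => h; apply: nrm0_eq0; have := nrm_ge0 x; nra.
have E1 u v : (u - v) - T (u - v) = (u - T u) - (v - T v).
  by rewrite linearB !opprB !addrA [RHS](ACl (1 * 4 * 3 * 2)).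
(* [w] comes from choice; it is linear because Id - T is injective. *)
have lin : linear w.
  move=> a x y; apply/eqP; rewrite -subr_eq0; apply/eqP; apply: inj.
  have E2 u v : (a *: u + v) - T (a *: u + v) = a *: (u - T u) + (v - T v).
    by rewrite linearP scalerBr opprD addrACA.
  by rewrite E1 E2 (wP _).1 (wP x).1 (wP y).1 subrr.
pose wL := GRing.isLinear.Build _ _ _ _ w lin.
pose W : {linear H -> H} := HB.pack w wL.
exists W; split => [y|x|y]; [exact: (wP y).1| |exact: (wP y).2].
apply/eqP; rewrite -subr_eq0; apply/eqP; apply: inj.
by rewrite E1 -[W _]/(w _) (wP _).1 subrr.
Qed.

End resolvent.

(** * Holomorphy of the matrix entries *)

Section holomorphic.
Context {R : realType} {H : hilbertType R}.

Lemma holomorphic_at_nrm (U : R[i] -> {linear H -> H}) z : holomorphic_at U z ->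
  exists2 D : {linear H -> H}, bounded_op D & forall e : R, 0 < e ->
    exists2 d : R, 0 < d & forall w, nrm (w - z) < d -> forall x,
      nrm (U w x - U z x - (w - z) *: D x) <= e * nrm (w - z) * nrm x.
Proof.
move=> [D [Db UD]]; exists D => // e e0.
pose F w := opnorm (fun x => (w - z)^-1 *: (U w x - U z x) - D x).
have : \forall w \near z^', (F w <= e%:E)%E.
  have /fine_cvgP[fin /cvgrPdist_lt/(_ e e0) lt] := UD.
  near=> w; have finw : F w \is a fin_num by near: w.
  rewrite -(fineK finw) lee_fin.
  have : `|0 - fine (F w)| < e by near: w.
  by rewrite sub0r normrN => /ltW; apply: le_trans; exact: ler_norm.
move=> /nbhs_nrmP[d d0 dP]; exists d => // w wd x.
have [->|wz] := eqVneq w z.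
  by rewrite !subrr scale0r subr0 !nrm0 mulr0 mul0r.
have wz0 : w - z != 0 by rewrite subr_eq0.
have := opnorm_le x _ (dP w wd wz).
have -> : U w x - U z x - (w - z) *: D x =
    (w - z) *: ((w - z)^-1 *: (U w x - U z x) - D x).
  by rewrite scalerBr scalerA divff// scale1r.
move=> h; rewrite nrmZ.
have -> : e * nrm (w - z) * nrm x = nrm (w - z) * (e * nrm x) by ring.
apply: ler_wpM2l; first exact: nrm_ge0.
apply: h => a y.
have -> : U w (a *: y) - U z (a *: y) = a *: (U w y - U z y).
  by rewrite [U w _]linearZ [U z _]linearZ scalerBr.
by rewrite [D _]linearZ [in RHS]scalerBr !scalerA mulrC.
Unshelve. all: by end_near. Qed.

(** W is given pointwise, with one bound near z. The resolvent identities [E1] and [E2] express its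
    increments through those of U and Ut; the derivative is <W(z) (Dt x0 - D e), f> with x0 = W(z)
    (e - U(z) e). *)
Lemma resolvent_entry_differentiable (U Ut W : R[i] -> {linear H -> H}) z (M r : R) :
  0 < r -> (forall w, nrm (w - z) < r -> forall y, nrm (W w y) <= M * nrm y) ->
  (forall w, nrm (w - z) < r -> forall x, W w (x - Ut w x) = x) ->
  (forall y, W z y - Ut z (W z y) = y) ->
  holomorphic_at U z -> holomorphic_at Ut z ->
  forall e f, differentiable
    ((fun w => hdot (W w (e - U w e)) f) : R[i] -> R[i]) z.
Proof.
move=> r0 WM Wl Wr Uh Uth e f; have hP := @hdot_psd R H.
have [D Db DP] := holomorphic_at_nrm Uh.
have [Dt Dtb DtP] := holomorphic_at_nrm Uth.
have [Mt Mt0 DtM] := bounded_op_nrm Dtb.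
set x0 := W z (e - U z e); pose v := Dt x0 - D e; set y0 := W z v.
have Mp : 0 <= `|M| by [].
have {}WM w : nrm (w - z) < r -> forall y, nrm (W w y) <= `|M| * nrm y.
  by move=> wr y; rewrite (le_trans (WM w wr y))// ler_wpM2r ?nrm_ge0// ler_norm.
pose A1 := `|M| * (nrm e + nrm x0) * nrm f.
pose A2 := `|M| * ((Mt + 1) * nrm y0) * nrm f.
have A10 : 0 <= A1 by rewrite !mulr_ge0 ?addr_ge0 ?nrm_ge0.
have A20 : 0 <= A2 by rewrite !mulr_ge0 ?addr_ge0 ?nrm_ge0.
apply/differentiable_nrmP; exists (hdot (W z v) f) => eps eps0.
pose e1 := eps / (2 * (A1 + 1)).
have e10 : 0 < e1 by rewrite divr_gt0// mulr_gt0// ltr_wpDl.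
have [d1 d10 d1P] := DP _ e10; have [d2 d20 d2P] := DtP _ e10.
have [d3 d30 d3P] := DtP 1 ltr01.
pose e2 := eps / (2 * (A2 + 1)).
have e20 : 0 < e2 by rewrite divr_gt0// mulr_gt0// ltr_wpDl.
exists (Num.min r (Num.min (Num.min d1 d2) (Num.min d3 e2))).
  by rewrite !lt_min r0 d10 d20 d30.
move=> w; rewrite !lt_min => /andP[wr /andP[/andP[w1 w2] /andP[w3 we]]].
have n0 := nrm_ge0 (w - z).
pose rho := (Ut w x0 - Ut z x0 - (w - z) *: Dt x0) - (U w e - U z e - (w - z) *: D e).
have hx0 : x0 - Ut z x0 = e - U z e by exact: Wr.
have E1 : W w (e - U w e) - x0 = W w (rho + (w - z) *: v).
  rewrite -{1}(Wl w wr x0) -linearB; congr (W w _).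
  rewrite /rho /v scalerBr; move: hx0.
  move: (Ut w x0) (Ut z x0) (U w e) (U z e) (_ *: Dt x0) (_ *: D e) => p q u uz a b hx.
  have -> : e = x0 - q + uz by rewrite hx subrK.
  rewrite !opprB !addrA [LHS](ACl (5 * 2 * 3 * 4 * (1 * 6)))/= subrr addr0.
  by rewrite [RHS](ACl (1 * 2 * 5 * 6 * (7 * 3) * (4 * 8)))/= !subrr !addr0.
have E2 : W w v - y0 = W w (Ut w y0 - Ut z y0).
  rewrite -{1}(Wl w wr y0) -linearB; congr (W w _).
  by rewrite -{1}(Wr v) opprB addrC addrA subrK.
have -> : hdot (W w (e - U w e)) f - hdot (W z (e - U z e)) f -
    hdot (W z v) f * (w - z) =
    hdot (W w rho) f + (w - z) * hdot (W w (Ut w y0 - Ut z y0)) f.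
  rewrite -/x0 -/y0 -(psdBl hP) E1 [W w (_ + _)]linearD [W w (_ *: _)]linearZ -E2.
  by rewrite (psdDl hP) (psdZl hP) (psdBl hP); ring.
apply: (le_trans (ler_nrmD _ _)); rewrite nrmM.
have B1 : nrm (hdot (W w rho) f) <= e1 * A1 * nrm (w - z).
  apply: (le_trans (nrm_hdot_le _ _)).
  have -> : e1 * A1 * nrm (w - z) =
    `|M| * (e1 * nrm (w - z) * nrm x0 + e1 * nrm (w - z) * nrm e) * nrm f.
    by rewrite /A1; ring.
  rewrite ler_wpM2r ?nrm_ge0// (le_trans (WM w wr _))// ler_wpM2l//.
  by rewrite (le_trans (ler_nrmB _ _))// lerD ?d1P ?d2P.
have B2 : nrm (hdot (W w (Ut w y0 - Ut z y0)) f) <= A2 * nrm (w - z).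
  apply: (le_trans (nrm_hdot_le _ _)).
  have -> : A2 * nrm (w - z) = `|M| * ((Mt + 1) * nrm y0 * nrm (w - z)) * nrm f.
    by rewrite /A2; ring.
  rewrite ler_wpM2r ?nrm_ge0// (le_trans (WM w wr _))// ler_wpM2l//.
  rewrite -(subrK ((w - z) *: Dt y0) (Ut w y0 - Ut z y0)).
  apply: (le_trans (ler_nrmD _ _)); rewrite nrmZ.
  have := d3P w w3 y0; have := ler_wpM2l n0 (DtM y0); lra.
have C1 : e1 * A1 <= eps / 2.
  by rewrite /e1 mulrAC ler_pdivrMr ?mulr_gt0 ?ltr_wpDl//; nra.
have C2 : A2 * nrm (w - z) <= eps / 2.
  have := we; rewrite /e2 ltr_pdivlMr ?mulr_gt0 ?ltr_wpDl//; nra.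
have := ler_wpM2r n0 C1; have := ler_wpM2l n0 B2; have := ler_wpM2l n0 C2; lra.
Qed.

Lemma compact_rectangle (a b c d : R) : compact (rectangle a b c d).
Proof.
pose f (p : R * R) : R[i] := p.1 +i* p.2.
have -> : rectangle a b c d = f @` (`[a, b]%classic `*` `[c, d]%classic).
  apply/seteqP; split=> [[x y] /= [xab ycd]|_ [[x y] [/= xab ycd] <-]].
    by exists (x, y) => //; split; rewrite /= in_itv.
  by move: xab ycd; rewrite !in_itv.
apply: continuous_compact; last first.
  by apply: compact_setX; exact: segment_compact.
apply: continuous_subspaceT => p U /nbhs_nrmP[e e0 eU].
have e20 : 0 < e / 2 by rewrite divr_gt0.
exists (ball p.1 (e / 2), ball p.2 (e / 2)).
  by split; apply: nbhsx_ballx.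
move=> [x y] [/= bx by_]; apply: eU.
rewrite (le_lt_trans (nrm_le_ReIm _))//= distrC [X in _ + X]distrC.
by move: bx by_; rewrite /ball /=; lra.
Qed.

End holomorphic.

(** * The determinant whose zeros are counted *)

Section zero_count.
Context {R : realType} {H : hilbertType R}.

Lemma orthonormal_expansion m (e : nat -> H) x :
  hdot (psd_residue hdot m e x) (psd_residue hdot m e x) = 0 ->
  x = \sum_(i < m) hdot x (e i) *: e i.
Proof. by move=> /hdot_eq0/eqP; rewrite subr_eq0 => /eqP. Qed.

(** det G is at most exp(M t) on the square and at least exp(- C0 t) at c. At [z j] the coordinates
    of the kernel vectors annihilate G from the left, which gives a zero of order [d j]. Jensen's
    inequality and 1 - k <= exp(- k) conclude. *)
Lemma zero_count_le (U Ut W : R[i] -> {linear H -> H}) (V0 : {linear H -> H})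
    (O : set R[i]) c (s D M C0 t : R) (J : finType) (z : J -> R[i])
    (d : J -> nat) (v : forall j, 'I_(d j) -> H) :
  0 < s -> 0 < D -> 0 < M -> 0 < C0 ->
  (forall w, square (square_corner c s) (2 * s) w ->
    exists2 r : R, 0 < r & forall w', nrm (w' - w) < r -> O w') ->
  (forall w, O w -> [/\ forall y, W w y - Ut w (W w y) = y,
    forall x, W w (x - Ut w x) = x & forall y, nrm (W w y) <= M * nrm y]) ->
  (forall w, square (square_corner c s) (2 * s) w -> holomorphic_at U w) ->
  (forall w, square (square_corner c s) (2 * s) w -> holomorphic_at Ut w) ->
  (forall w, square (square_corner c s) (2 * s) w ->
    (trace_norm (U w \- Ut w)%R <= t%:E)%E) ->
  (forall x, V0 (x - U c x) = x) -> (forall y, nrm (V0 y) <= C0 * nrm y) ->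
  injective z ->
  (forall j, D <= complex.Im c + s - complex.Im (z j) <= s / 10) ->
  (forall j, `|complex.Re (z j) - complex.Re c| <= s / 10) ->
  (forall j k, U (z j) (v j k) - v j k = 0) ->
  (forall j (a : 'I_(d j) -> R[i]), \sum_k a k *: v j k = 0 -> forall k, a k = 0) ->
  (\sum_j d j)%:R * (9 / 20 * (D / s)) <= (M + C0) * t.
Proof.
move=> s0 D0 M0 C00 QO OW Uh Uth Kt V0l V0C zI zD zc vker vfree.
have hP := @hdot_psd R H.
have QOw w : square (square_corner c s) (2 * s) w -> O w.
  by move=> /QO[r r0]; apply; rewrite subrr nrm0.
have cQ : square (square_corner c s) (2 * s) c.
  rewrite /square /square_corner; case: (c) => c1 c2 /=.
  rewrite ?(mul0r, mul1r, addr0, add0r, subr0, sub0r, oppr0, mulr0).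
  by split; apply/andP; split; lra.
have zQ j : square (square_corner c s) (2 * s) (z j).
  have := zD j; have := zc j; rewrite ler_norml /square /square_corner.
  case: (c) => c1 c2 /= /andP[? ?] /andP[? ?].
  rewrite ?(mul0r, mul1r, addr0, add0r, subr0, sub0r, oppr0, mulr0).
  by split; apply/andP; split; lra.
(* All the kernel vectors in one list; e is an orthonormal basis of their span. *)
pose sv := [seq v (tag x) (tagged x) | x : {j : J & 'I_(d j)}].
have [m [e [_ [eo _ ev]]]] := psd_gram_schmidt hP (size sv) (nth 0 sv).
have vE j k : v j k = \sum_(i < m) hdot (v j k) (e i) *: e i.
  apply: orthonormal_expansion.
  have vsv : v j k \in sv.
    by apply/mapP; exists (Tagged (fun j => 'I_(d j)) k); rewrite ?mem_enum.
  by have := ev (index (v j k) sv); rewrite index_mem nth_index//; apply.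
pose F w x := W w (x - U w x).
have FD w n (a : 'I_n -> R[i]) (x : 'I_n -> H) :
    F w (\sum_k a k *: x k) = \sum_k a k *: F w (x k).
  rewrite /F [U w _]linear_sum -sumrB [LHS]linear_sum; apply: eq_bigr => k _.
  by rewrite [U w _]linearZ -scalerBr [LHS]linearZ.
have FE w x : O w -> F w x = x + (\- W w) ((U w \- Ut w) x).
  move=> /OW[_ Wl _]; rewrite /F -{3}(Wl x)/= -linearB; congr (W w _).
  by rewrite opprB addrA subrK.
pose Fi x := V0 (x - Ut c x).
have FiF x : Fi (F c x) = x.
  by have [Wr _ _] := OW _ (QOw _ cQ); rewrite /Fi Wr V0l.
have FiD n (a : 'I_n -> R[i]) (x : 'I_n -> H) :
    Fi (\sum_k a k *: x k) = \sum_k a k *: Fi (x k).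
  rewrite /Fi [Ut c _]linear_sum -sumrB [LHS]linear_sum; apply: eq_bigr => k _.
  by rewrite [Ut c _]linearZ -scalerBr [LHS]linearZ.
have FiE x : Fi x = x + V0 ((U c \- Ut c) x).
  by rewrite /Fi -{3}(V0l x) -linearD; congr (V0 _); rewrite /= addrA subrK.
have [m' [f [C' [fo fC' fe]]]] := psd_gram_schmidt hP m (fun i => F c (e i)).
have FeE i : (i < m)%N -> F c (e i) = \sum_(l < m') hdot (F c (e i)) (f l) *: f l.
  by move=> im; apply: orthonormal_expansion; exact: fe.
(* As the f l span the image of the e i under F c, the inverse of G0 is the    *)
(* matrix of F c ^-1, which is another trace class perturbation of the identity. *)
pose G0 : 'M[R[i]]_(m, m') := \matrix_(i, l) hdot (F c (e i)) (f l).
pose G1 : 'M[R[i]]_(m', m) := \matrix_(l, j) hdot (Fi (f l)) (e j).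
have G01 : G0 *m G1 = 1%:M.
  apply/matrixP => i j; rewrite !mxE -val_eqE/= -eo//.
  rewrite -{1}(FiF (e i)) FeE// FiD (psd_suml hP).
  by apply: eq_bigr => l _; rewrite !mxE (psdZl hP).
have C'G0 : (\matrix_(k, i) C' k i : 'M[R[i]]_(m', m)) *m G0 = 1%:M.
  apply/matrixP => k l; rewrite !mxE -val_eqE/= -fo// [in RHS]fC'//.
  rewrite (psd_suml hP); apply: eq_bigr => i _.
  by rewrite !mxE (psdZl hP).
(* G0 has a right and a left inverse, so it is square. *)
have mm' : m' = m.
  by apply/eqP; rewrite eqn_leq (mulmx1_min G01) (mulmx1_min C'G0).
subst m'.
pose G w : 'M[R[i]]_m := \matrix_(i, l) hdot (F w (e i)) (f l).
have Gbound w : square (square_corner c s) (2 * s) w -> nrm (\det (G w)) <= expR (M * t).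
  move=> wQ; have wO := QOw _ wQ.
  have -> : G w = \matrix_(i < m, l < m)
      hdot (e i + (\- W w) ((U w \- Ut w) (e i))) (f l).
    by apply/matrixP => i l; rewrite !mxE FE.
  apply: (det_perturbation_le (K := U w \- Ut w) (S := \- W w) (Kt _ wQ)) => // x.
  by rewrite /= nrmN; have [_ _] := OW _ wO; apply.
have G1bound : nrm (\det G1) <= expR (C0 * t).
  have -> : G1 = \matrix_(i < m, l < m)
      hdot (f i + V0 ((U c \- Ut c) (f i))) (e l).
    by apply/matrixP => i l; rewrite !mxE FiE.
  exact: (det_perturbation_le (K := U c \- Ut c) (S := V0) (Kt _ cQ)).
have dG w i l : square (square_corner c s) (2 * s) w ->
    differentiable ((fun w => G w i l) : R[i] -> R[i]) w.
  move=> wQ; have [r r0 rO] := QO _ wQ.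
  have -> : (fun w => G w i l) = (fun w => hdot (W w (e i - U w (e i))) (f l)).
    by apply/funext => x; rewrite mxE.
  apply: (@resolvent_entry_differentiable _ _ U Ut W w M r) => //.
  - by move=> w' /rO/OW[].
  - by move=> w' /rO/OW[].
  - by have [] := OW _ (QOw _ wQ).
  - exact: Uh.
  - exact: Uth.
have := @jensen_square R J z d (fun w => \det (G w)) c s (expR (M * t)) D s0 D0 zI.
have H1 w : square (square_corner c s) (2 * s) w ->
    differentiable ((fun w => \det (G w)) : R[i] -> R[i]) w.
  by move=> wQ; apply: differentiable_det => i l; exact: dG.
move=> /(_ H1 zD zc) H2.
have {H2} : nrm (\det (G c)) <= expR (M * t) * (1 - 9 / 20 * (D / s)) ^+ (\sum_j d j)%N.
  apply: H2 => [j|w [wQ _]]; last exact: Gbound.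
  pose V : 'M[R[i]]_(d j, m) := \matrix_(k, i) hdot (v j k) (e i).
  apply: (@det_vanishing R m (d j) G (z j) V).
  - apply: inj_row_free => u uV; apply/rowP => k; rewrite mxE.
    apply: (vfree j (fun k => u ord0 k)).
    under eq_bigr do rewrite vE scaler_sumr.
    rewrite exchange_big big1// => i _ /=.
    under eq_bigr do rewrite scalerA.
    rewrite -scaler_suml.
    move/rowP: uV => /(_ i); rewrite !mxE => uV.
    rewrite (_ : \sum_k _ = 0) ?scale0r// -[RHS]uV.
    by apply: eq_bigr => l _; rewrite !mxE.
  - apply/matrixP => k l; rewrite !mxE.
    transitivity (hdot (F (z j) (v j k)) (f l)).
      rewrite [in RHS]vE FD (psd_suml hP); apply: eq_bigr => i _.
      by rewrite !mxE (psdZl hP).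
    by rewrite /F -opprB vker oppr0 linear0 (psd0l hP).
  - by move=> i l; exact: dG.
move=> Gc; set n := (\sum_j d j)%N in Gc *; set k := 9 / 20 * (D / s) in Gc *.
have Ds : 0 < D / s by rewrite divr_gt0.
have GcE : G c = G0 by [].
have G1c : 1 <= nrm (\det (G c)) * expR (C0 * t).
  rewrite -[leLHS](@nrm1 R) -(det1 R[i] m) -G01 det_mulmx nrmM.
  by rewrite ler_wpM2l ?nrm_ge0.
(* Without zeros the claim is 0 <= (M + C0) t, where t >= 0 comes from the empty pairing. *)
have [n0|n0] := posnP n.
  rewrite n0 mul0r mulr_ge0//; first by rewrite addr_ge0// ltW.
  have := @trace_norm_pairing _ _ (U c \- Ut c) V0 t C0 0 (fun=> 0) (fun=> 0)
    (Kt _ cQ) C00 V0C.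
  by rewrite big_ord0 pmulr_rge0//; apply.
(* Some zero exists, so D <= s / 10; the base 1 - k is then nonnegative and can be compared with
   exp(- k) under powers. *)
have k1 : 0 <= 1 - k.
  have [j _] : exists j : J, true.
    apply: contrapT => nJ; move: n0; rewrite /n big1// => j _.
    by case: nJ; exists j.
  have := zD j => /andP[h1 h2].
  have : D / s <= 1 / 10 by rewrite ler_pdivrMr//; lra.
  by rewrite /k; lra.
have kexp : (1 - k) ^+ n <= expR (- k) ^+ n.
  by rewrite lerXn2r ?nnegrE ?expR_ge0 ?expR_ge1Dx.
have : expR 0 <= expR ((M + C0) * t - n%:R * k).
  rewrite expR0 (le_trans G1c)//.
  apply: (le_trans (ler_wpM2r (expR_ge0 _) (le_trans Gc (ler_wpM2l (expR_ge0 _) kexp)))).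
  rewrite -expRM_natl -!expRD ler_expR; lra.
by rewrite ler_expR subr_ge0.
Qed.

End zero_count.

(** * From the extended-real count to finite families *)

Section counting.
Context {R : realType} {H : hilbertType R}.

Lemma dim_ker_witness (f : H -> H) (X : R) :
  (forall n (v : 'I_n -> H), (forall i, f (v i) = 0) ->
    (forall a : 'I_n -> R[i], \sum_i a i *: v i = 0 -> forall i, a i = 0) ->
    n%:R <= X) ->
  exists n (v : 'I_n -> H), [/\ forall i, f (v i) = 0,
    forall a : 'I_n -> R[i], \sum_i a i *: v i = 0 -> forall i, a i = 0 &
    dim_ker f = n%:R%:E].
Proof.
move=> fX; pose P n := `[< exists v : 'I_n -> H, (forall i, f (v i) = 0) /\
  (forall a : 'I_n -> R[i], \sum_i a i *: v i = 0 -> forall i, a i = 0) >].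
have P0 : exists n, P n.
  by exists 0%N; apply/asboolP; exists (fun=> 0); split => [[]|a _ []].
have Pb n : P n -> (n <= Num.Def.archi_bound `|X|)%N.
  move=> /asboolP[v [v0 vf]]; rewrite -(ler_nat R) (le_trans (fX _ _ v0 vf))//.
  by rewrite (le_trans (ler_norm _))// ltW//; exact: archi_boundP.
case: (ex_maxnP P0 Pb) => n /asboolP[v [v0 vf]] nmax.
exists n, v; split => //; apply/eqP; rewrite eq_le; apply/andP; split.
  apply: ge_ereal_sup => _ [k [v' v'P] <-]; rewrite lee_fin ler_nat.
  by apply: nmax; apply/asboolP; exists v'.
by apply: ereal_sup_ubound; exists n => //; exists v.
Qed.

(** The count is a supremum over finite sets of resonances, so it is enough to bound finitely many
    points, each with an independent family in its kernel. *)
Lemma resonance_count_le (Y0 : \bar R) (U : R[i] -> {linear H -> H})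
    (Omega : set R[i]) (X : R) :
  (forall n (z : 'I_n -> R[i]) (d : 'I_n -> nat) (v : forall j, 'I_(d j) -> H),
    injective z -> (forall j, Omega (z j) /\ half_plane Y0 (z j)) ->
    (forall j k, U (z j) (v j k) - v j k = 0) ->
    (forall j (a : 'I_(d j) -> R[i]), \sum_k a k *: v j k = 0 ->
      forall k, a k = 0) ->
    (\sum_j d j)%:R <= X) ->
  (resonance_count Y0 U Omega <= X%:E)%E.
Proof.
move=> UX; apply: ge_ereal_sup => _ [A [/finite_seqP[s0 ->] AO] <-].
set s := undup s0.
have su : uniq s by rewrite undup_uniq.
have -> : [set` s0] = [set` s] by apply/seteqP; split => x; rewrite /= mem_undup.
have {}AO x : x \in s -> Omega x /\ half_plane Y0 x.
  by rewrite mem_undup => /AO[? []].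
rewrite -fsbig_seq// (big_nth 0) big_mkord.
pose z (j : 'I_(size s)) := s`_j.
have zO j : Omega (z j) /\ half_plane Y0 (z j) by apply: AO; rewrite mem_nth.
have zI : injective z.
  by move=> i j /eqP; rewrite nth_uniq// => /eqP /val_inj.
have wit (j : 'I_(size s)) : exists p : {n : nat & 'I_n -> H},
    [/\ forall i, U (z j) (tagged p i) - tagged p i = 0,
    forall a : 'I_(tag p) -> R[i], \sum_i a i *: tagged p i = 0 -> forall i, a i = 0 &
    multiplicity U (z j) = (tag p)%:R%:E].
  (* The hypothesis at a single point bounds the dimension of its kernel, so the multiplicity is
     attained by a finite family. *)
  have [|n [v [v0 vf vE]]] := @dim_ker_witness (fun x => U (z j) x - x) X.
    move=> n v v0 vf.
    have := UX 1%N (fun=> z j) (fun=> n) (fun=> v).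
    by rewrite big_ord1; apply => // i k _; rewrite (ord1 i) (ord1 k).
  by exists (existT _ n v).
have /choice[p pP] := wit.
rewrite (eq_bigr (fun j => ((tag (p j))%:R)%:E)); last by move=> j _; case: (pP j).
rewrite sumEFin lee_fin -natr_sum.
apply: (UX _ z (fun j => tag (p j)) (fun j => tagged (p j))) => //.
  by move=> j k; case: (pP j).
by move=> j; case: (pP j).
Qed.

End counting.

(** * Choice of the square, and the theorem *)

Section bound.
Context {R : realType}.

Lemma powR_five_halves (a : R) : 0 <= a -> a `^ (5 / 2) = a ^+ 2 * Num.sqrt a.
Proof.
move=> a0; have -> : 5 / 2 = 2%:R + 2^-1 :> R by field.
rewrite powRD; last by apply/implyP => /eqP; lra.
by rewrite powR_mulrn// powR12_sqrt.
Qed.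

Lemma resonance_bound (Y0 : \bar R) (Y0_gt0 : (0 < Y0)%E)
    (Y1 : R) (C0 C0' C1 c Cg : set R[i] -> R) (a1 a2 a3 : R) :
  a1 < a2 -> 0 < a3 ->
  exists C : R, forall (H : nat -> hilbertType R)
      (U Ut : forall N, R[i] -> {linear H N -> H N}) (gamma : nat -> R),
    hypothesis1 Y0 Y1 C0 C0' C1 U -> hypothesis2 Y0 c Cg U Ut gamma ->
    forall N (delta : R), 0 < delta ->
      (resonance_count Y0 (U N) (rectangle a1 a2 (- a3) (- delta))
        <= (C * gamma N / delta `^ (5 / 2))%:E)%E.
Proof.
move=> a12 a30.
(* The half side s makes the rectangle fit in the region of size s / 10 under the middle of the top
   edge, and puts the centre below - Y1. *)
pose mid := (a1 + a2) / 2; pose s := 10 * (a2 - a1) + 10 * a3 + `|Y1| + 1.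
have Y1s : `|Y1| < s by rewrite /s; lra.
have s0 : 0 < s by apply: le_lt_trans Y1s.
have Y1n := ler_norm Y1.
have s1 : 10 * (a2 - a1) <= s by rewrite /s; have := normr_ge0 Y1; lra.
have s2 : 10 * a3 <= s by rewrite /s; have := normr_ge0 Y1; lra.
(* For all delta <= a3, [K0] contains the squares with room for neighbourhoods and [K1] contains
   their centres; the constants attached to them are thus independent of delta. *)
pose K0 : set R[i] := rectangle (mid - s - 1) (mid + s + 1) (- (a3 + 2 * s + 1)) 0.
pose K1 : set R[i] := rectangle mid mid (- (a3 + s)) (- Y1).
pose B := 40 / 9 * s * (4 / c K0 + C0' K1 * a3) * `|Cg K0|.
exists (B * Num.sqrt a3) => H U Ut gamma h1 h2 N delta delta0.
have K0hp : K0 `<=` half_plane Y0.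
  by move=> w [_ /andP[_ w0]]; rewrite /half_plane/= (le_lt_trans _ Y0_gt0)// lee_fin.
have K0c : compact K0 by exact: compact_rectangle.
have K1c : compact K1 by exact: compact_rectangle.
have [c0 cP] := Ut_contraction h2 K0c K0hp.
have [C00 C0P] : 0 < C0' K1 /\ forall N z, K1 z ->
      inverse_norm_le (fun x => x - U N z x) (C0' K1).
  by apply: (U_inverse_below h1 K1c) => w [_ /andP[]].
have g0 := gamma_gt0 h2 N.
have B0 : 0 <= B.
  by rewrite !mulr_ge0// ?ltW// addr_gt0 ?divr_gt0// mulr_gt0.
apply: resonance_count_le => n z d v zI zO vker vfree.
(* For delta > a3 the rectangle is empty. *)
have [da|da] := leP delta a3; last first.
  rewrite big1 => [|j _]; last first.
    have [[_ /andP[? ?]] _] := zO j; have : delta <= a3 by lra.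
    by rewrite leNgt da.
  by rewrite divr_ge0 ?powR_ge0// mulr_ge0 ?(ltW g0)// mulr_ge0// sqrtr_ge0.
(* The top edge is Im z = - delta / 2, halfway between the real axis and the rectangle. On [O],
   where Im w < - delta / 4, the inverse of Id - Ut has norm at most [M]. *)
pose ctr : R[i] := mid +i* (- (delta / 2) - s).
pose M := 4 / (c K0 * delta); have M0 : 0 < M by rewrite divr_gt0// mulr_gt0.
pose O : set R[i] := [set w | K0 w /\ complex.Im w < - (delta / 4)].
have Qw w : square (square_corner ctr s) (2 * s) w ->
    mid - s <= complex.Re w <= mid + s /\
    - (delta / 2) - 2 * s <= complex.Im w <= - (delta / 2).
  rewrite /square /square_corner /ctr /=.
  rewrite ?(mul0r, mul1r, addr0, add0r, subr0, sub0r, oppr0, mulr0).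
  by move=> [/andP[? ?] /andP[? ?]]; split; apply/andP; split; lra.
have QK0 w : square (square_corner ctr s) (2 * s) w -> K0 w.
  by move=> /Qw[/andP[? ?] /andP[? ?]]; split; apply/andP; split; lra.
have /choice[W WP] w : exists W : {linear H N -> H N}, O w ->
    [/\ forall y, W y - Ut N w (W y) = y, forall x, W (x - Ut N w x) = x &
        forall y, nrm (W y) <= M * nrm y].
  have [[Kw wd]|nO] := pselect (O w); last by exists \0.
  have w0 : complex.Im w < 0 by lra.
  have cw : 0 < c K0 * `|complex.Im w| by rewrite mulr_gt0// normr_gt0 lt_eqF.
  have [_ /(_ w0) inv] := cP N w Kw.
  have q1 : 0 <= (1 + c K0 * `|complex.Im w|)^-1 < 1.
    rewrite invr_ge0 ltW ?addr_gt0//= invf_lt1 ?addr_gt0//; lra.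
  have [W [W1 W2 W3]] := resolvent q1 inv.
  exists W => _; split => // y; rewrite (le_trans (W3 y))// ler_wpM2r ?nrm_ge0//.
  have -> : (1 + c K0 * `|complex.Im w|)^-1 / (1 - (1 + c K0 * `|complex.Im w|)^-1)
      = (c K0 * `|complex.Im w|)^-1.
    set x := c K0 * _ in cw *; have x1 : 1 + x != 0 by rewrite gt_eqF// addr_gt0.
    have -> : 1 - (1 + x)^-1 = x / (1 + x) by field.
    by rewrite invfM invrK mulrCA mulVf// mulr1.
  rewrite /M -[leRHS]invrK lef_pV2 ?posrE ?invr_gt0//.
  rewrite invf_div ler_pdivrMr// -mulrA ler_pM2l// ltr0_norm//; lra.
have [V0 [[_ V0l _] V0b]] : inverse_norm_le (fun x => x - U N ctr x) (C0' K1).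
  apply: C0P; split; apply/andP; split; rewrite /ctr //=; lra.
have key : (\sum_j d j)%:R * (9 / 20 * (delta / 2 / s)) <=
    (M + C0' K1) * (Cg K0 * gamma N).
  apply: (@zero_count_le _ _ (U N) (Ut N) W V0 O ctr s (delta / 2) M (C0' K1)
    (Cg K0 * gamma N) _ z d v) => //.
  - by rewrite divr_gt0.
  - move=> w wQ; exists (Num.min 1 (delta / 4)).
      by rewrite lt_min ltr01 divr_gt0.
    move=> w'; rewrite lt_min => /andP[w1 w2].
    have [/andP[? ?] /andP[? ?]] := Qw _ wQ.
    have := Re_le_nrm (w' - w); have := Im_le_nrm (w' - w).
    rewrite !raddfB/= !ler_norml => /andP[? ?] /andP[? ?].
    by split; [split; apply/andP; split|]; lra.
  - by move=> w /QK0/K0hp; exact: U_holomorphic h1 _ _.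
  - by move=> w /QK0/K0hp; exact: Ut_holomorphic h2 _ _.
  - by move=> w /QK0 wK; exact: (U_Ut_trace_norm h2 K0c K0hp N wK).
  - by move=> y; apply: opnorm_le => // a x; rewrite linearZ.
  - move=> j; have [[/andP[? ?] /andP[? ?]] _] := zO j.
    by rewrite /ctr/=; apply/andP; split; lra.
  - move=> j; have [[/andP[? ?] /andP[? ?]] _] := zO j.
    by rewrite /ctr/= ler_norml /mid; apply/andP; split; lra.
move: key; set m : R := _%:R => key.
have m0 : 0 <= m by exact: ler0n.
rewrite (powR_five_halves (ltW delta0)) ler_pdivlMr; last first.
  by rewrite mulr_gt0 ?exprn_gt0// sqrtr_gt0.
have rA : Num.sqrt delta <= Num.sqrt a3 by rewrite ler_wsqrtr.
(* Multiplying [key] by 40 s delta / 9 turns its left side into m delta^2; on the right, delta <= a3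
   removes the remaining delta. *)
have step : m * delta ^+ 2 <= B * gamma N.
  have Cg0 : Cg K0 * gamma N <= `|Cg K0| * gamma N by rewrite ler_pM2r// ler_norm.
  have F0 : 0 < 40 / 9 * s * delta by rewrite !mulr_gt0// divr_gt0.
  have e1 : 40 / 9 * s * delta * (m * (9 / 20 * (delta / 2 / s))) = m * delta ^+ 2.
    by field; rewrite gt_eqF.
  have e2 : 40 / 9 * s * delta * ((M + C0' K1) * (Cg K0 * gamma N)) =
      40 / 9 * s * (4 / c K0 + C0' K1 * delta) * (Cg K0 * gamma N).
    by rewrite /M; field; rewrite !gt_eqF.
  have := ler_wpM2l (ltW F0) key; rewrite e1 e2 => /le_trans; apply.
  rewrite /B -[leRHS]mulrA; apply: le_trans (ler_wpM2l _ Cg0) _.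
    by rewrite !mulr_ge0 ?ltW// addr_gt0 ?divr_gt0// mulr_gt0.
  apply: ler_wpM2r; first by rewrite mulr_ge0// ltW.
  apply: ler_wpM2l; first by rewrite mulr_ge0 ?ltW.
  by rewrite lerD2l ler_pM2l.
rewrite mulrA [leRHS]mulrAC; apply: ler_pM => //.
by rewrite mulr_ge0// sqr_ge0.
Qed.

(** The imaginary parts of the points of the compact closure form a compact set that misses 0, hence
    a neighbourhood of 0. *)
Lemma distance_real_axis (Omega : set R[i]) (b : R) :
  (forall z, Omega z -> nrm z <= b) ->
  closure Omega `&` [set z | complex.Im z = 0] = set0 ->
  exists2 e : R, 0 < e & forall z, Omega z -> e <= `|complex.Im z|.
Proof.
move=> Ob O0.
pose A : set R := (@complex.Im R) @` (rectangle (- b) b (- b) b `&` closure Omega).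
have Ac : compact A.
  apply: continuous_compact; last first.
    apply: compact_closedI; [exact: compact_rectangle|exact: closed_closure].
  apply: continuous_subspaceT => z V /nbhs_ballP[e /= e0 eV].
  apply/nbhs_nrmP; exists e => // w wz; apply: eV.
  by rewrite /ball/= distrC -raddfB (le_lt_trans (Im_le_nrm _)).
have A0 : ~ A 0.
  by move=> [z [_ zO] z0]; have : set0 z by rewrite -O0; split.
have : nbhs (0 : R) (~` A).
  apply: open_nbhs_nbhs; split => //; rewrite openC.
  exact: compact_closed (@Rhausdorff R) Ac.
move=> /nbhs_ballP[e /= e0 eA]; exists e => // z zO; rewrite leNgt; apply/negP => ze.
apply: (eA (complex.Im z)); first by rewrite /ball/= sub0r normrN.
exists z => //; split; last exact: subset_closure.
have := Re_le_nrm z; have := Im_le_nrm z; have := Ob z zO.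
rewrite !ler_norml => ? /andP[? ?] /andP[? ?].
by split; apply/andP; split; lra.
Qed.

End bound.

Theorem theorem1 (R : realType) (Y0 : \bar R) (Y0_gt0 : (0 < Y0)%E)
    (Y1 : R) (C0 C0' C1 c Cg : set R[i] -> R) (a1 a2 a3 : R)
    (a12 : a1 < a2) (a3_gt0 : 0 < a3) :
  (exists C : R, forall (H : nat -> hilbertType R)
      (U Ut : forall N, R[i] -> {linear H N -> H N}) (gamma : nat -> R),
    hypothesis1 Y0 Y1 C0 C0' C1 U -> hypothesis2 Y0 c Cg U Ut gamma ->
    forall delta : nat -> R, (forall N, 0 < delta N) -> bounded_fun delta ->
    exists N0, forall N, (N0 <= N)%N ->
      (resonance_count Y0 (U N) (rectangle a1 a2 (- a3) (- delta N))
        <= (C * gamma N / delta N `^ (5 / 2))%:E)%E) /\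
  (forall (H : nat -> hilbertType R)
      (U Ut : forall N, R[i] -> {linear H N -> H N}) (gamma : nat -> R),
    hypothesis1 Y0 Y1 C0 C0' C1 U -> hypothesis2 Y0 c Cg U Ut gamma ->
    gamma =o_\oo (fun N => N%:R : R) ->
    forall Omega : set R[i], bounded_set Omega ->
      closure Omega `&` [set z | complex.Im z = 0] = set0 ->
      ((N%:R^-1)%:E * resonance_count Y0 (U N) Omega)%E @[N --> \oo] --> 0%E).
Proof.
have hb := @resonance_bound R Y0 Y0_gt0 Y1 C0 C0' C1 c Cg; split.
  have [C CP] := hb _ _ _ a12 a3_gt0; exists C => H U Ut gamma h1 h2 delta d0 _.
  by exists 0%N => N _; exact: CP h1 h2 N _ (d0 N).
move=> H U Ut gamma h1 h2 go Omega Ob O0.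
have [b b0 bP] : exists2 b : R, 0 < b & forall z, Omega z -> nrm z <= b.
  case: Ob => M [Mr MP]; exists (`|complex.Re M| + 1); first by rewrite ltr_wpDl.
  move=> z zO; have := MP (M + 1) _ z zO; rewrite ltrDl ltr01 => /(_ isT) zM.
  rewrite -lecR -normr_nrm (le_trans zM)// rmorphD/= lerD2r -{1}(RRe_real Mr) lecR.
  exact: ler_norm.
have [e e0 eP] := distance_real_axis bP O0.
have [|C CP] := hb (- b) b b _ b0; first by rewrite gtrN.
pose k := C / e `^ (5 / 2).
(* No resonance has positive imaginary part and |Im z| >= e on Omega, so its resonances lie in the
   rectangle of the first estimate with delta = e. *)
have Omega_le N : (resonance_count Y0 (U N) Omega <= (k * gamma N)%:E)%E.
  rewrite /k mulrAC; apply: le_trans (CP H U Ut gamma h1 h2 N e e0).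
  apply: le_ereal_sup => _ [A [Af AO] <-]; exists A => //; split => // z /AO[zO zr].
  split => //; have := eP z zO; have := Re_le_nrm z; have := Im_le_nrm z.
  have := bP z zO; have := @U_no_resonance_above _ _ _ _ _ _ _ _ h1 N z.
  have [Im0 /(_ isT)/(_ zr)//|Im0 _] := ltP 0 (complex.Im z).
  rewrite ler0_norm// !ler_norml => ? ? /andP[? ?] ?.
  by split; apply/andP; split; lra.
clearbody k.
have k0 N : (0 <= resonance_count Y0 (U N) Omega)%E.
  apply: esum_ge0 => z _; apply: ereal_sup_ubound; exists 0%N => //.
  by exists (fun=> 0); split => [[]|a _ []].
apply: (@squeeze_cvge _ _ _ _ (cst 0%E) _ (fun N => (N%:R^-1 * (k * gamma N))%:E)).
- apply: nearW => N /=; rewrite EFinM mule_ge0 ?lee_fin ?invr_ge0//=.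
  by rewrite lee_wpmul2l ?lee_fin ?invr_ge0.
- exact: cvg_cst.
apply: cvg_EFin; first exact: nearW.
apply/cvgrPdist_le => eps eps0.
have d0 : 0 < eps / (`|k| + 1) by rewrite divr_gt0// ltr_wpDl.
have /eqoP/(_ _ d0) := go; apply: filterS => N; rewrite /= sub0r normrN !normrM.
rewrite normfV !(ger0_norm (ler0n R N)) => gN.
have [->|N0] := posnP N; first by rewrite mulr0n invr0 mul0r; exact: ltW.
rewrite mulrC ler_pdivrMr ?ltr0n//.
apply: (le_trans (ler_wpM2l (normr_ge0 k) gN)); rewrite mulrA ler_wpM2r//.
rewrite mulrCA; apply: ler_piMr; first exact: ltW.
by rewrite ler_pdivrMr ?ltr_wpDl// mul1r lerDl.
Qed.
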